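(* Let $\rho>0$, $A=\Delta_\kappa+\rho^2$, and for $c\in\mathbb{R}$ let $T_t^c=e^{-t(A-c)}$. Then: (1) For $1\le p<2$ and $c<\frac{2\rho^2}{p'}$, $T_t^c$ is not hypercyclic on $L^p_{\rho,\kappa}(\mathbb{R}^n)$. (2) For $2<p<\infty$ and $c<\frac{2\rho^2}{p}$, $T_t^c$ is not hypercyclic on $L^p_{\rho,\kappa}(\mathbb{R}^n)$.
   Context: All functions are complex-valued; $p'$ is the conjugate index, $1/p+1/p'=1$ ($1/p'=0$ if $p=1$). Dunkl setting: let $n\ge2$, $R\subset\mathbb{R}^n\setminus\{0\}$ a (finite, reduced) root system with positive roots $R_+$, $\sigma_\nu x=x-2\frac{\langle\nu,x\rangle}{|\nu|^2}\nu$ the reflections, $G$ the finite group generated by $\{\sigma_\nu:\nu\in R\}$, and $\kappa:R\to[0,\infty)$ a multiplicity function, i.e. $\kappa(g\nu)=\kappa(\nu)$ for $g\in G$. The Dunkl operators are $T_jf(x)=\frac{\partial f}{\partial x_j}(x)+\sum_{\nu\in R_+}\kappa(\nu)\nu_j\frac{f(x)-f(\sigma_\nu x)}{\langle\nu,x\rangle}$, and the Dunkl Laplacian is $\Delta_\kappa=-\sum_{j=1}^nT_j^2$. Put $h_\kappa^2(x)=\prod_{\nu\in R_+}|\langle x,\nu\rangle|^{2\kappa(\nu)}$ and $\gamma=\sum_{\nu\in R_+}\kappa(\nu)$. The Dunkl kernel $E_\kappa(x,\xi)$ is the analytic function with $T_jE_\kappa(\cdot,\xi)=\xi_jE_\kappa(\cdot,\xi)$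 for all $j$ and $E_\kappa(0,\xi)=1$. For $t>0$ the heat kernel is $\Gamma_\kappa(t,x,y)=M_\kappa t^{-(n/2+\gamma)}e^{-(|x|^2+|y|^2)/(4t)}E_\kappa\big(\frac{x}{\sqrt{2t}},\frac{y}{\sqrt{2t}}\big)$, with constant $M_\kappa$ such that $\int_{\mathbb{R}^n}\Gamma_\kappa(t,x,y)h_\kappa^2(y)dy=1$. The semigroup is $e^{-t(\Delta_\kappa+\rho^2-c)}f(x)=e^{-t(\rho^2-c)}\int_{\mathbb{R}^n}\Gamma_\kappa(t,x,y)f(y)h_\kappa^2(y)dy$ for $t>0$ (identity for $t=0$). $\gamma_p=|\frac2p-1|$. For $\nu>0$, $z>0$, $K_\nu(z)=\frac12(\frac z2)^\nu\int_0^\infty e^{-(t+z^2/(4t))}t^{-\nu-1}dt$ and $\tilde K_\nu(z)=z^\nu K_\nu(z)$. For $1\le p<\infty$, $L^p_{\rho,\kappa}(\mathbb{R}^n)=L^p(\mathbb{R}^n,(\tilde K_{n/2+\gamma}(\rho|x|))^{\gamma_pp}h_\kappa^2(x)dx)$. A semigroup $T_t$ of bounded operators on a Banach space $\mathcal{B}$ is hypercyclic if there is $v\in\mathcal{B}$ such that $\{T_tv:t\ge0\}$ is dense in $\mathcal{B}$. *)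

(* Defs.v *)
From HB Require Import structures.
From mathcomp Require Import all_boot all_order all_algebra finmap complex.
From mathcomp Require Import all_classical all_reals all_analysis.

Set Implicit Arguments.
Unset Strict Implicit.
Unset Printing Implicit Defensive.

Import Order.TTheory GRing.Theory Num.Theory.
Import numFieldNormedType.Exports.

Local Open Scope classical_set_scope.
Local Open Scope ring_scope.

(* R^n is ['rV[R]_n], with the sigma-algebra generated by the coordinates
   (i.e. the Borel sets).  Lebesgue measure is the iterated product of the
   one-dimensional one, transported along the bijection
   R * R^n -> R^(n+1), (a, v) |-> (a, v_0, ..., v_(n-1)). *)

Definition rV_display : measure_display.
Proof. exact: default_measure_display. Qed.

Section measurable_rV.
Context {R : realType} {n : nat}.

Definition rV_coord (i : 'I_n) (x : 'rV[R]_n) : measurableTypeR R := x 0 i.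

Let rV_set0 : g_sigma_preimage rV_coord set0.
Proof. exact: sigma_algebra0. Qed.

Let rV_setC A : g_sigma_preimage rV_coord A -> g_sigma_preimage rV_coord (~` A).
Proof. exact: sigma_algebraC. Qed.

Let rV_bigcup (F : _^nat) : (forall i, g_sigma_preimage rV_coord (F i)) ->
  g_sigma_preimage rV_coord (\bigcup_i (F i)).
Proof. exact: sigma_algebra_bigcup. Qed.

HB.instance Definition _ := @isMeasurable.Build rV_display
  'rV[R]_n (g_sigma_preimage rV_coord) rV_set0 rV_setC rV_bigcup.

End measurable_rV.

Lemma measurable_rV_coord {R : realType} {n : nat} (i : 'I_n) :
  measurable_fun [set: 'rV[R]_n] (rV_coord i).
Proof.
move=> _ Y mY; rewrite setTI; apply: sub_sigma_algebra => /=.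
rewrite -bigcup_seq/=; exists i => /=; first by rewrite mem_index_enum.
by exists Y => //; rewrite setTI.
Qed.

Lemma measurable_fun_rVP {R : realType} {n : nat} d (T : measurableType d) (f : T -> 'rV[R]_n) :
  (forall i, measurable_fun [set: T] (rV_coord i \o f)) ->
  measurable_fun [set: T] f.
Proof.
move=> mf; have H : g_sigma_preimage (fun i => rV_coord i \o f) `<=` measurable.
  apply: smallest_sub; first exact: sigma_algebra_measurable.
  rewrite -bigcup_seq/= => A [i _] [B mB <-]; exact: mf.
move: H; rewrite g_sigma_preimage_comp => H _ A mA.
by apply: H; exists A.
Qed.

Section rV_cons.
Context {R : realType} {n : nat}.

Definition rV_cons (u : measurableTypeR R * 'rV[R]_n) : 'rV[R]_n.+1 :=
  \row_i (if unlift ord0 i is Some j then u.2 0 j else u.1).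

Definition rV_uncons (x : 'rV[R]_n.+1) : measurableTypeR R * 'rV[R]_n :=
  (x 0 ord0, \row_i x 0 (lift ord0 i)).

Lemma rV_consK : cancel rV_cons rV_uncons.
Proof.
move=> [a v]; rewrite /rV_uncons; congr (_, _); first by rewrite mxE unlift_none.
by apply/rowP => i; rewrite !mxE liftK.
Qed.

Lemma measurable_rV_cons : measurable_fun setT rV_cons.
Proof.
apply: measurable_fun_rVP => i; case: (unliftP ord0 i) => [j ->|->].
  rewrite (_ : _ \o _ = rV_coord j \o snd).
    by apply: measurableT_comp; [exact: measurable_rV_coord|exact: measurable_snd].
  by apply/funext => u; rewrite /rV_coord/= mxE liftK.
rewrite (_ : _ \o _ = fst); first exact: measurable_fst.
by apply/funext => u; rewrite /rV_coord/= mxE unlift_none.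
Qed.

Lemma measurable_rV_uncons : measurable_fun setT rV_uncons.
Proof.
apply: measurable_fun_pair; first exact: (measurable_rV_coord ord0).
apply: measurable_fun_rVP => i.
rewrite (_ : _ \o _ = rV_coord (lift ord0 i)); first exact: measurable_rV_coord.
by apply/funext => u; rewrite /rV_coord/= mxE.
Qed.

Variable mu : {sigma_finite_measure set 'rV[R]_n -> \bar R}.

Definition rV_product : set 'rV[R]_n.+1 -> \bar R :=
  pushforward (@lebesgue_measure R \x mu)%E rV_cons.

HB.instance Definition _ := Measure.copy rV_product
  (measure_function_pushforward__canonical__measure_function_Measure
     (@lebesgue_measure R \x mu)%E measurable_rV_cons).

Let rV_product_sigma_finite : sigma_finite setT rV_product.
Proof.
have /sigma_finiteP[F [TF ndF Foo]] := sigma_finiteT (@lebesgue_measure R).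
have /sigma_finiteP[G [TG ndG Goo]] := sigma_finiteT mu.
exists (fun k => rV_uncons @^-1` (F k `*` G k)).
  rewrite -preimage_bigcup; apply/seteqP; split=> // x _ /=.
  have [k _ Fk] : (\bigcup_i F i) (rV_uncons x).1 by rewrite -TF.
  have [l _ Gl] : (\bigcup_i G i) (rV_uncons x).2 by rewrite -TG.
  exists (maxn k l) => //; split.
  - by move: Fk; exact/subsetPset/ndF/leq_maxl.
  - by move: Gl; exact/subsetPset/ndG/leq_maxr.
move=> k; have [mF ooF] := Foo k; have [mG ooG] := Goo k; split.
  rewrite -[X in measurable X]setTI; apply: measurable_rV_uncons => //.
  exact: measurableX.
rewrite /rV_product /pushforward -comp_preimage.
rewrite (_ : rV_uncons \o rV_cons = idfun); last first.
  by apply/funext => u /=; rewrite rV_consK.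
rewrite [X in (X < _)%E](_ : _ = (lebesgue_measure \x mu)%E (F k `*` G k)) //.
by rewrite product_measure1E// lte_mul_pinfty// ge0_fin_numE.
Qed.

HB.instance Definition _ :=
  @Measure_isSigmaFinite.Build _ _ _ rV_product rV_product_sigma_finite.

End rV_cons.

Fixpoint lebesgue_rV {R : realType} (n : nat) :
    {sigma_finite_measure set 'rV[R]_n -> \bar R} :=
  match n with
  | 0%N => \d_(0 : 'rV[R]_0)
  | m.+1 => rV_product (lebesgue_rV m)
  end.

Lemma lebesgue_rV_box (R : realType) (n : nat) (A : 'I_n -> set R) :
  (forall i, @measurable _ (measurableTypeR R) (A i)) ->
  lebesgue_rV n [set x | forall i, A i (x 0 i)] =
  (\prod_(i < n) lebesgue_measure (A i))%E.
Proof.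
elim: n A => [A _|n IH A mA].
  rewrite big_ord0 /= diracE mem_set //=; by case.
rewrite big_ord_recl /= -IH // /rV_product /pushforward.
rewrite -product_measure1E//; last first.
  rewrite [X in measurable X](_ : _ =
     (\bigcap_(i in [set: 'I_n]) (rV_coord (R:=R) i @^-1` (A (lift ord0 i))))); last first.
    by apply/seteqP; split=> [x H i _|x H i]; [exact: H| exact: (H i)].
  apply: fin_bigcap_measurable => // i _; rewrite -[X in measurable X]setTI.
  by apply: measurable_rV_coord.
congr ((_ \x _)%E _); apply/seteqP; split => [[a v] /= H|[a v] /= [Ha Hv] i].
  split; first by have := H ord0; rewrite mxE unlift_none.
  by move=> i; have := H (lift ord0 i); rewrite mxE liftK.
by rewrite mxE; case: unliftP => [j ->|->//]; exact: Hv.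
Qed.

Section dunkl.
Context {R : realType} {n : nat}.
Implicit Types (x y xi : 'rV[R]_n) (t : R) (Rt Rp : {fset 'rV[R]_n}).

Definition dot x y : R := \sum_i x 0 i * y 0 i.

Definition reflection (a x : 'rV[R]_n) : 'rV[R]_n :=
  x - (2 * dot a x / dot a a) *: a.

(* A root system need neither be crystallographic nor span R^n. *)
Definition root_system Rt : Prop :=
  [/\ 0 \notin Rt,
      forall a b, a \in Rt -> b \in Rt -> reflection a b \in Rt &
      forall a (k : R), a \in Rt -> (k *: a \in Rt) = (k == 1) || (k == -1)].

Definition positive_roots Rt Rp : Prop :=
  exists b : 'rV[R]_n,
    (forall a, a \in Rt -> dot a b != 0) /\
    (forall a, (a \in Rp) = (a \in Rt) && (0 < dot a b)).

Inductive reflection_group Rt : ('rV[R]_n -> 'rV[R]_n) -> Prop :=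
| refl_group_gen a : a \in Rt -> reflection_group Rt (reflection a)
| refl_group_id : reflection_group Rt id
| refl_group_comp g h :
    reflection_group Rt g -> reflection_group Rt h ->
    reflection_group Rt (g \o h)
| refl_group_inv g h :
    reflection_group Rt g -> cancel g h -> cancel h g -> reflection_group Rt h.

Definition multiplicity_function Rt (kappa : 'rV[R]_n -> R) : Prop :=
  (forall a, a \in Rt -> 0 <= kappa a) /\
  (forall g a, reflection_group Rt g -> a \in Rt -> kappa (g a) = kappa a).

(* On the hyperplane <a, x> = 0 the quotient takes its limiting value. *)
Definition reflection_quotient (a : 'rV[R]_n) (f : 'rV[R]_n -> R) x : R :=
  if dot a x == 0 then 2 / dot a a * 'D_a f x
  else (f x - f (reflection a x)) / dot a x.

Section multiplicity.
Variables (Rp : {fset 'rV[R]_n}) (kappa : 'rV[R]_n -> R).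

Definition dunkl_op (j : 'I_n) (f : 'rV[R]_n -> R) x : R :=
  'D_(delta_mx 0 j) f x +
  \sum_(a <- Rp) kappa a * a 0 j * reflection_quotient a f x.

Definition dunkl_weight x : R := \prod_(a <- Rp) `|dot x a| `^ (2 * kappa a).

Definition gamma_kappa : R := \sum_(a <- Rp) kappa a.

End multiplicity.
End dunkl.

Definition homogeneous_part {R : realType} {m : nat}
    (c : {ffun 'I_m -> nat} -> R) (h : 'rV[R]_m) (k : nat) : R :=
  \sum_(a : {ffun 'I_m -> 'I_k.+1} | (\sum_i a i == k)%N)
    c [ffun i => a i : nat] * \prod_i h 0 i ^+ a i.

(* Near each point f is the sum of an absolutely convergent power series in m
   variables, grouped by total degree. *)
Definition real_analytic {R : realType} {m : nat} (f : 'rV[R]_m -> R) : Prop :=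
  forall x : 'rV[R]_m, exists (r : R) (c : {ffun 'I_m -> nat} -> R),
    0 < r /\ forall h : 'rV[R]_m, `|h| < r ->
      cvgn (series (homogeneous_part (fun a => `|c a|) (map_mx Num.norm h))) /\
      series (homogeneous_part c h) @ \oo --> f (x + h).

Section dunkl_kernel.
Context {R : realType} {n : nat}.
Variables (Rp : {fset 'rV[R]_n}) (kappa : 'rV[R]_n -> R).

(* For real x and xi the Dunkl kernel is real-valued. *)
Definition dunkl_kernel (E : 'rV[R]_n -> 'rV[R]_n -> R) : Prop :=
  [/\ real_analytic (fun z : 'rV[R]_(n + n) => E (lsubmx z) (rsubmx z)),
      forall j x xi, dunkl_op Rp kappa j (E^~ xi) x = xi 0 j * E x xi &
      forall xi, E 0 xi = 1].

Variables (E : 'rV[R]_n -> 'rV[R]_n -> R) (M : R).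

Definition heat_kernel (t : R) (x y : 'rV[R]_n) : R :=
  M * t `^ (- (n%:R / 2 + gamma_kappa Rp kappa))
    * expR (- (dot x x + dot y y) / (4 * t))
    * E ((Num.sqrt (2 * t))^-1 *: x) ((Num.sqrt (2 * t))^-1 *: y).

Definition heat_normalized : Prop :=
  forall (t : R) (x : 'rV[R]_n), 0 < t ->
    (\int[lebesgue_rV n]_y (heat_kernel t x y * dunkl_weight Rp kappa y)%:E
      = 1)%E.

Definition Cintegral (f : 'rV[R]_n -> R[i]) : R[i] :=
  Complex (\int[lebesgue_rV n]_x complex.Re (f x)) (\int[lebesgue_rV n]_x complex.Im (f x)).

Definition shifted_semigroup (rho c t : R) (f : 'rV[R]_n -> R[i]) :
    'rV[R]_n -> R[i] :=
  if t == 0 then f else fun x =>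
    (expR (- t * (rho ^+ 2 - c)))%:C%C *
    Cintegral (fun y => (heat_kernel t x y * dunkl_weight Rp kappa y)%:C%C * f y).

End dunkl_kernel.

Definition besselK {R : realType} (nu z : R) : R :=
  2^-1 * (z / 2) `^ nu *
  \int[lebesgue_measure]_(t in `]0, +oo[)
    (expR (- (t + z ^+ 2 / (4 * t))) * t `^ (- nu - 1)).

Definition besselKt {R : realType} (nu z : R) : R := z `^ nu * besselK nu z.

Definition gamma_p {R : realType} (p : R) : R := `|2 / p - 1|.

Section Lp.
Context {R : realType} {n : nat}.

(* L^p(R^n, w(x) dx), as a space of functions with the L^p seminorm rather than
   as its quotient by equality almost everywhere. *)
Definition Lp_norm (w : 'rV[R]_n -> R) (p : R) (f : 'rV[R]_n -> R[i]) : \bar R :=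
  ((\int[lebesgue_rV n]_x (ComplexField.Normc.normc (f x) `^ p * w x)%:E)
    `^ p^-1)%E.

Definition Lp_space (w : 'rV[R]_n -> R) (p : R) : set ('rV[R]_n -> R[i]) :=
  [set f | [/\ measurable_fun setT (fun x => complex.Re (f x)),
               measurable_fun setT (fun x => complex.Im (f x)) &
               (Lp_norm w p f < +oo)%E]].

Definition rho_kappa_weight (Rp : {fset 'rV[R]_n}) (kappa : 'rV[R]_n -> R)
    (rho p : R) (x : 'rV[R]_n) : R :=
  besselKt (n%:R / 2 + gamma_kappa Rp kappa) (rho * Num.sqrt (dot x x))
    `^ (gamma_p p * p) * dunkl_weight Rp kappa x.

End Lp.

Definition hypercyclic {R : realType} {V : zmodType} (B : set V)
    (N : V -> \bar R) (T : R -> V -> V) : Prop :=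
  exists2 v, B v & forall g, B g -> forall e : R, 0 < e ->
    exists2 t, 0 <= t & (N (T t v - g)%R < e%:E)%E.

Definition hypercyclic_on_Lp {R : realType} {n : nat} (Rp : {fset 'rV[R]_n})
    (kappa : 'rV[R]_n -> R) (E : 'rV[R]_n -> 'rV[R]_n -> R)
    (M rho p c : R) : Prop :=
  let w := rho_kappa_weight Rp kappa rho p in
  hypercyclic (Lp_space w p) (Lp_norm w p)
    (shifted_semigroup Rp kappa E M rho c).

(* Main.v *)
Require Import Defs.
From mathcomp Require Import all_boot all_order all_algebra finmap complex.
From mathcomp Require Import all_classical all_reals all_analysis.
From mathcomp Require Import measurable_realfun ring lra.
Import Order.TTheory GRing.Theory Num.Theory.
Import numFieldNormedType.Exports.
Local Open Scope ring_scope.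
Set Implicit Arguments.
Unset Strict Implicit.
Unset Printing Implicit Defensive.
Local Open Scope classical_set_scope.

(** To rule out a dense orbit it suffices to find a seminorm that is bounded on
    the unit ball of the weighted L^p space, bounded along every orbit, and not
    identically zero: a dense orbit would come within distance one of every
    multiple of a test function, and the seminorms of these multiples are
    unbounded.  The seminorm used here is the mean of [|f|] against the Gaussian
    [Gamma(1, 0, x)] (definition [gaussian_mean], conclusion in
    [not_hypercyclic]).

    By Tonelli the semigroup can be moved onto the Gaussian, which it carries to
    [Gamma(1 + t, 0, x)] ([gaussian_evolution]).  Up to a factor 2, the mean of
    [T_t f] is thus at most
      [exp (- t (rho^2 - c))] times the integral of [Gamma(1 + t, 0, x) |f| h^2]
    ([gaussian_mean_shifted_semigroup]), and it remains to bound this uniformly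
    in [t] ([gaussian_pairing_bound]).  Let [b = rho * gamma_p].  Away from the
    origin the weight is at least a multiple of [exp (- b p |x|) h^2], because the modified Bessel
    function [besselKt nu z] is at least a multiple of [exp (- z)]
    ([besselKt_ge]).  Splitting [|f|] at the height [exp (b |x|)] leaves on one
    side an exponential moment of the Gaussian and on the other the p-th power of
    [|f|] against the weight, provided that the Gaussian is at most a multiple of
    [exp (- b |x|)].  Completing squares, both cost a factor which is about
    [exp (b^2 t)]; the factor [exp (- t (rho^2 - c))] pays for it as soon as
    [b^2 < rho^2 - c], that is [c < rho^2 (1 - gamma_p^2) = 4 rho^2 / (p p')].
    This is weaker than both hypotheses on [c] in the theorem.

    Moving the semigroup requires three facts on the Dunkl kernel [E]: it is
    nonnegative, [E (k x) xi = E x (k xi)], and it is symmetric.  Contracting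
    the eigenvalue equations of the Dunkl operators with [x] gives the radial
    equation
      [x . grad f = <x, xi> f - sum_a kappa_a (f - f o sigma_a)],
    and since the multiplicities are nonnegative it obeys a maximum principle
    ([euler_solution_le0]).  This gives nonnegativity and also uniqueness, from
    which homogeneity, invariance under reflections and then symmetry follow.
    With these, [Gamma(1, 0, x) Gamma(t, x, y)] is as a function of [x] a
    multiple of a heat kernel, whose mass is one. *)

Local Notation normc := ComplexField.Normc.normc.

(** * Euclidean structure and reflections *)

Section dot.
Context {R : realType} {n : nat}.
Implicit Types (x y z a : 'rV[R]_n).

Lemma dotC x y : dot x y = dot y x.
Proof. by apply: eq_bigr => i _; rewrite mulrC. Qed.

Lemma dotDl x y z : dot (x + y) z = dot x z + dot y z.
Proof. by rewrite /dot -big_split /=; apply: eq_bigr => i _; rewrite mxE mulrDl. Qed.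

Lemma dotZl k x y : dot (k *: x) y = k * dot x y.
Proof. by rewrite /dot mulr_sumr; apply: eq_bigr => i _; rewrite mxE mulrA. Qed.

Lemma dotDr x y z : dot z (x + y) = dot z x + dot z y.
Proof. by rewrite dotC dotDl !(dotC z). Qed.

Lemma dotZr k x y : dot y (k *: x) = k * dot y x.
Proof. by rewrite dotC dotZl dotC. Qed.

Lemma dotNl x y : dot (- x) y = - dot x y.
Proof. by rewrite -scaleN1r dotZl mulN1r. Qed.

Lemma dotNr x y : dot y (- x) = - dot y x.
Proof. by rewrite dotC dotNl dotC. Qed.

Lemma dot0l x : dot 0 x = 0.
Proof. by rewrite -(scale0r 0) dotZl mul0r. Qed.

Lemma dot0r x : dot x 0 = 0.
Proof. by rewrite dotC dot0l. Qed.

Lemma dot_ge0 x : 0 <= dot x x.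
Proof. by apply: sumr_ge0 => i _; rewrite -expr2 sqr_ge0. Qed.

Lemma dot_eq0 x : (dot x x == 0) = (x == 0).
Proof.
apply/idP/eqP => [|->]; last by rewrite dot0l.
rewrite psumr_eq0 => [/allP h|i _]; last by rewrite -expr2 sqr_ge0.
apply/rowP => i; have /= := h i (mem_index_enum _).
by rewrite mulf_eq0 orbb mxE => /eqP.
Qed.

Lemma ler_coord_norm x i : `|x 0 i| <= `|x|.
Proof.
rewrite [leRHS]/Num.norm /= mx_normrE; apply/bigmax_geP; right => /=.
by exists (0, i).
Qed.

Lemma dot_mxnorm x y : `|dot x y| <= dot (const_mx 1) (map_mx Num.norm x) * `|y|.
Proof.
rewrite /dot mulr_suml; apply: le_trans (ler_norm_sum _ _ _) _.
apply: ler_sum => i _; rewrite !mxE mul1r normrM ler_wpM2l//.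
exact: ler_coord_norm.
Qed.

Lemma sqrt_coord_le x i : `|x 0 i| <= Num.sqrt (dot x x).
Proof.
rewrite -sqrtr_sqr ler_wsqrtr// /dot (bigD1 i)//= -expr2 lerDl.
by apply: sumr_ge0 => j _; rewrite -expr2 sqr_ge0.
Qed.

Lemma dot_cauchy x y : dot x y <= Num.sqrt (dot x x) * Num.sqrt (dot y y).
Proof.
have [->|y0] := eqVneq y 0; first by rewrite !dot0r sqrtr0 mulr0.
have yy : 0 < dot y y by rewrite lt_neqAle eq_sym dot_eq0 y0 dot_ge0.
rewrite -sqrtrM ?dot_ge0// (le_trans (ler_norm _))// -sqrtr_sqr ler_wsqrtr//.
have := dot_ge0 (dot y y *: x - dot x y *: y).
rewrite !(dotDl, dotDr, dotZl, dotZr, dotNl, dotNr) (dotC y x) => h.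
have : 0 <= dot y y * (dot x x * dot y y - dot x y ^+ 2).
  by apply: le_trans h _; rewrite le_eqVlt; apply/orP; left; apply/eqP; ring.
by rewrite pmulr_rge0// subr_ge0.
Qed.

Lemma reflectionE a x : dot a x = 0 -> reflection a x = x.
Proof. by move=> h; rewrite /reflection h mulr0 mul0r scale0r subr0. Qed.

Lemma reflection_isom a x y : dot (reflection a x) (reflection a y) = dot x y.
Proof.
have [->|a0] := eqVneq a 0; first by rewrite /reflection !scaler0 !subr0.
have : dot a a != 0 by rewrite dot_eq0.
rewrite /reflection !(dotDl, dotDr, dotZl, dotZr, dotNl, dotNr) (dotC x a) => h.
by field.
Qed.

Lemma reflectionK a : involutive (reflection a).
Proof.
move=> x; have [->|a0] := eqVneq a 0; first by rewrite /reflection !scaler0 !subr0.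
have h : dot a a != 0 by rewrite dot_eq0.
rewrite /reflection !(dotDr, dotNr, dotZr) -[RHS]addr0 -addrA; congr (_ + _).
rewrite -opprD -scalerDl; apply/eqP; rewrite oppr_eq0 scaler_eq0.
apply/orP; left; apply/eqP; by field.
Qed.

Lemma reflectionZ a k x : reflection a (k *: x) = k *: reflection a x.
Proof.
rewrite /reflection dotZr scalerBr scalerA; congr (_ - _ *: _); lra.
Qed.

Lemma reflectionD a x y : reflection a (x + y) = reflection a x + reflection a y.
Proof.
by rewrite /reflection dotDr mulrDr mulrDl scalerDl opprD addrACA.
Qed.

Lemma reflectionN a x : reflection (- a) x = reflection a x.
Proof.
rewrite /reflection !dotNl !dotNr opprK scalerN -scaleNr; congr (_ - _ *: _); lra.
Qed.

(** The conjugate of a reflection by an isometry is the reflection in the image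
    of the root. *)
Lemma reflection_conj a b x :
  reflection b (reflection a x) = reflection a (reflection (reflection a b) x).
Proof.
set r := reflection a.
have -> : r (reflection (r b) x) = r x - (2 * dot (r b) x / dot (r b) (r b)) *: r (r b).
  by rewrite {1}/reflection /r reflectionD -scaleNr reflectionZ scaleNr.
rewrite /r reflectionK reflection_isom -(reflection_isom a (reflection a b) x).
by rewrite reflectionK.
Qed.

End dot.

(** * Real-analytic functions *)

Section analytic.
Context {R : realType} {m : nat}.
Implicit Types (c : {ffun 'I_m -> nat} -> R) (h : 'rV[R]_m).

(** The coordinates of [h] are at most [|h| / d] times [d], and a monomial of
    degree [k] scales by the [k]-th power. *)
Lemma homogeneous_part_le c h d k : 0 < d ->
  `|homogeneous_part c h k| <=
    (`|h| / d) ^+ k *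
    homogeneous_part (fun a => `|c a|) (map_mx Num.norm (const_mx d)) k.
Proof.
move=> d0; rewrite /homogeneous_part mulr_sumr.
apply: le_trans (ler_norm_sum _ _ _) _; apply: ler_sum => a /eqP ak.
rewrite normrM [leRHS]mulrCA ler_wpM2l// normr_prod.
have -> : (`|h| / d) ^+ k = \prod_i (`|h| / d) ^+ a i by rewrite prodrXr ak.
rewrite -big_split/=; apply: ler_prod => i _.
rewrite !mxE normrX exprn_ge0//= -exprMn lerXn2r ?nnegrE ?mulr_ge0 ?invr_ge0//.
  exact: ltW.
by rewrite (gtr0_norm d0) divfK ?gt_eqF// ler_coord_norm.
Qed.

Lemma homogeneous_part0 c h : homogeneous_part c h 0 = homogeneous_part c 0 0.
Proof.
apply: eq_bigr => a a0; congr (_ * _); apply: eq_bigr => i _.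
by have -> : a i = 0%N :> nat by move: a0; rewrite sum_nat_eq0 => /forallP/(_ i)/eqP.
Qed.

(** One exponent is 1 and the others are 0, so both sides are the same
    coordinate. *)
Lemma prod_expr_sum1 (a : 'I_m -> nat) h : (\sum_i a i = 1)%N ->
  \prod_i h 0 i ^+ a i = \sum_i (a i)%:R * h 0 i.
Proof.
move=> a1.
have [j aj] : exists j, a j != 0%N.
  apply/not_existsP => a0; move: a1; rewrite big1// => i _.
  by apply/eqP/negPn/negP; exact: a0.
have aE i : a i = (i == j).
  move: a1; rewrite (bigD1 j)//=; case: (eqVneq i j) => [->|ij].
    by move: aj; case: (a j) => [//|[//|k]]; rewrite !addSn.
  rewrite (bigD1 i)//=; move: aj; case: (a j) => [//|k] _; case: (a i) => [//|l].
  by rewrite !addnS.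
rewrite (bigD1 j)//= [RHS](bigD1 j)//= !aE eqxx expr1 mul1r.
by rewrite !big1 ?mulr1 ?addr0// => i /negbTE ij; rewrite aE ij ?mul0r.
Qed.

Lemma homogeneous_part1 c : exists l, forall h, homogeneous_part c h 1 = dot l h.
Proof.
exists (\row_i \sum_(a : {ffun 'I_m -> 'I_2} | (\sum_i a i == 1)%N)
    c [ffun i => a i : nat] * (a i)%:R) => h.
rewrite /dot /homogeneous_part.
under [RHS]eq_bigr do rewrite mxE mulr_suml.
rewrite exchange_big/=; apply: eq_bigr => a /eqP a1.
rewrite (prod_expr_sum1 _ a1) mulr_sumr.
by apply: eq_bigr => i _; rewrite mulrA.
Qed.

Lemma homogeneous_part_ge0 c h k : homogeneous_part (fun a => `|c a|) (map_mx Num.norm h) k >= 0.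
Proof.
apply: sumr_ge0 => a _; rewrite mulr_ge0// prodr_ge0// => i _.
by rewrite mxE exprn_ge0.
Qed.

(** The degree-one part of the power series is a linear form, and the parts of
    degree at least two are bounded at [h] by [(|h| / d) ^+ 2] times their
    absolute values at a fixed point of norm [d]. *)
Lemma analytic_expansion (f : 'rV[R]_m -> R) : real_analytic f ->
  forall x, exists (l : 'rV[R]_m) (C d : R), [/\ 0 < d, 0 <= C &
    forall h, `|h| <= d -> `|f (x + h) - f x - dot l h| <= C * `|h| ^+ 2].
Proof.
move=> + x; move=> /(_ x)[r [c [r0 fc]]].
have [l cl] := homogeneous_part1 c.
have d0 : 0 < r / 2 by rewrite divr_gt0.
set d := r / 2 in d0 *.
have dr : d < r by rewrite /d ltr_pdivrMr// mulr_natr mulr2n ltrDl.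
set q := homogeneous_part (fun a => `|c a|) (map_mx Num.norm (const_mx d)).
have q0 k : 0 <= q k by exact: homogeneous_part_ge0.
have nd : `|const_mx d : 'rV[R]_m| < r.
  apply: le_lt_trans dr; rewrite [leLHS]/Num.norm /= mx_normrE.
  by apply: bigmax_le => [|i _]; rewrite ?mxE ?gtr0_norm// ltW.
have [qcvg _] := fc _ nd.
have qS N : series q N <= limn (series q).
  apply: nondecreasing_cvgn_le => // i j ij.
  by apply: nondecreasing_series => // k _ _; exact: q0.
have f0 : f x = homogeneous_part c 0 0.
  have n0 : `|0 : 'rV[R]_m| < r by rewrite normr0.
  have [_] := fc 0 n0; rewrite addr0 => /cvg_unique; apply => //.
  apply: (@cvg_near_cst _ _ _ _ _).
  exists 1%N => // -[|N] //= _; apply/eqP; rewrite /series/= big_nat_recl//=.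
  rewrite big1 ?addr0// => i _; apply/eqP; rewrite -normr_le0.
  by apply: le_trans (homogeneous_part_le c 0 i.+1 d0) _; rewrite normr0 mul0r exprS mul0r mul0r.
exists l, (d ^- 2 * limn (series q)), d; split=> //.
  rewrite mulr_ge0 ?invr_ge0 ?exprn_ge0//; first exact: ltW.
  by apply: le_trans (qS 0%N); rewrite /series/= big_geq.
move=> h hd; have [_ fh] := fc h (le_lt_trans hd dr).
have : (fun N => `|series (homogeneous_part c h) N - f x - dot l h|) @ \oo -->
    `|f (x + h) - f x - dot l h|.
  by apply: cvg_norm; apply: cvgB; [apply: cvgB => //|]; exact: cvg_cst.
move=> cv; rewrite -(cvg_lim _ cv)//; apply: limr_le; first by apply: cvgP cv.
exists 2%N => // -[//|[//|N]] _ /=.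
rewrite /series/= big_nat_recl//= big_nat_recl//= homogeneous_part0 f0 cl.
rewrite [_ + (_ + _)]addrC addrK addrAC subrr add0r.
apply: le_trans (ler_norm_sum _ _ _) _.
apply: (@le_trans _ _ (\sum_(0 <= i < N) (`|h| / d) ^+ 2 * q i.+2)).
  apply: ler_sum => i _; apply: le_trans (homogeneous_part_le c h i.+2 d0) _.
  rewrite ler_wpM2r//; have hd0 : 0 <= `|h| / d by rewrite divr_ge0// ltW.
  rewrite -addn2 exprD ler_piMl ?exprn_ge0// exprn_ile1//.
  by rewrite ler_pdivrMr// mul1r.
rewrite -mulr_sumr exprMn exprVn -mulrA [leLHS]mulrCA -[leRHS]mulrA.
rewrite ler_wpM2l ?invr_ge0 ?exprn_ge0 ?(ltW d0)// [leLHS]mulrC ler_wpM2r ?exprn_ge0//.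
apply: le_trans (qS N.+2); rewrite /series/= !big_nat_recl//=.
by rewrite -[leLHS]add0r lerD//; rewrite -[leLHS]add0r lerD.
Qed.

(** The derivatives in all directions come from a single linear form; this is
    what allows the contraction of the Dunkl operators with [x]. *)
Lemma analytic_derive (f : 'rV[R]_m -> R) : real_analytic f ->
  forall x, exists l : 'rV[R]_m, forall v, is_derive x v f (dot l v).
Proof.
move=> fan x; have [l [C [d [d0 C0 H]]]] := analytic_expansion fan x.
exists l => v.
have cv : (fun h : R => h^-1 *: ((f \o shift x) (h *: v) - f x)) @ 0^' --> dot l v.
  apply/cvgrPdist_le => e e0; near=> h.
  have h0 : h != 0 by near: h; exact: nbhs_dnbhs_neq.
  have hd : `|h *: v| <= d.
    rewrite normrZ; apply: le_trans (_ : `|h| * (`|v| + 1) <= _).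
      by rewrite ler_wpM2l// lerDl.
    rewrite -ler_pdivlMr ?ltr_wpDl//; near: h; apply: dnbhs0_le.
    by rewrite divr_gt0// ltr_wpDl.
  have He := H _ hd; rewrite distrC [x + _]addrC dotZr in He.
  rewrite /= in He *; set A := f _ - f x in He *.
  have -> : dot l v - h^-1 *: A = h^-1 * (h * dot l v - A).
    by rewrite -[h^-1 *: A]/(h^-1 * A) [RHS]mulrBr mulKf.
  rewrite normrM normfV ler_pdivrMl ?normr_gt0//.
  apply: le_trans He _; rewrite normrZ exprMn mulrC -mulrA expr2 -mulrA ler_wpM2l//.
  rewrite mulrC; apply: le_trans (_ : `|h| * (`|v| ^+ 2 * C + 1) <= _).
    by rewrite mulrC ler_wpM2l// mulrC lerDl.
  rewrite -ler_pdivlMr ?ltr_wpDl ?mulr_ge0 ?exprn_ge0//; near: h; apply: dnbhs0_le.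
  by rewrite divr_gt0// ltr_wpDl// mulr_ge0 ?exprn_ge0.
split; first by apply/cvg_ex; exists (dot l v).
exact/cvg_lim.
Unshelve. all: by end_near. Qed.

Lemma rV_continuousP (f : 'rV[R]_m -> R) : continuous f <->
  (forall x e, 0 < e ->
    exists2 d, 0 < d & forall y, `|x - y| < d -> `|f x - f y| <= e).
Proof.
split=> [cf x e e0|H x].
  have /(proj1 (@cvgrPdist_le _ _ _ (nbhs x) (nbhs_filter x) _ _))/(_ _ e0) := cf x.
  move=> /(proj1 (@nbhs_ballP R 'rV[R]_m x _))[d d0 Hd]; exists d => // y xy.
  by apply: Hd; rewrite -ball_normE.
 apply: (proj2 (@cvgrPdist_le _ _ _ (nbhs x) (nbhs_filter x) _ _)).
move=> e e0; have [d d0 Hd] := H x e e0.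
apply: (proj2 (@nbhs_ballP R 'rV[R]_m x _)); exists d => // y.
by rewrite -ball_normE /=; exact: Hd.
Qed.

Lemma analytic_continuous (f : 'rV[R]_m -> R) : real_analytic f -> continuous f.
Proof.
move=> fan; apply/rV_continuousP => x e e0.
have [l [C [d [d0 C0 H]]]] := analytic_expansion fan x.
set L := dot (const_mx 1) (map_mx Num.norm l).
have L0 : 0 <= L by apply: sumr_ge0 => i _; rewrite !mxE mulr_ge0.
have K0 : 0 < L + C * d + 1 by rewrite ltr_wpDl// addr_ge0// mulr_ge0// ltW.
exists (Num.min d (e / (L + C * d + 1))); first by rewrite lt_min d0 divr_gt0.
move=> y; rewrite distrC lt_min => /andP[/ltW yd ye].
have {}ye : `|y - x| * (L + C * d + 1) <= e by rewrite -ler_pdivlMr// ltW.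
have Hy := H _ yd; rewrite subrKC in Hy.
apply: le_trans ye.
have -> : f x - f y = - (f y - f x - dot l (y - x)) - dot l (y - x) by ring.
apply: le_trans (ler_normB _ _) _. rewrite normrN.
apply: le_trans (lerD Hy (dot_mxnorm _ _)) _.
rewrite -/L expr2 mulrA -mulrDl mulrC ler_wpM2l//.
have := ler_wpM2l C0 yd; lra.
Qed.

End analytic.

(** * The radial equation and its maximum principle *)

Section euler.
Context {R : realType} {n : nat}.
Variables (Rp : {fset 'rV[R]_n}) (kappa : 'rV[R]_n -> R).
Implicit Types (x xi : 'rV[R]_n) (f : 'rV[R]_n -> R).

(** The eigenvalue equations of all Dunkl operators, contracted with the point:
    a single equation along rays, which couples a point only with its mirror
    images. *)
Definition euler_solution xi f : Prop :=
  continuous f /\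
  forall x, is_derive x x f
    (dot x xi * f x - \sum_(a <- Rp) kappa a * (f x - f (reflection a x))).

Lemma dot_continuous : continuous (fun x => dot x x).
Proof.
move=> x; have FF := nbhs_filter (x : 'rV[R]_n); rewrite /dot; apply: cvg_big => [|i _].
  by apply: add_continuous.
by apply: cvgM; exact: coord_continuous.
Qed.

Lemma compact_dot_ball r : compact [set x : 'rV[R]_n | dot x x <= r].
Proof.
apply: bounded_closed_compact.
  exists (Num.sqrt r); split=> [|M rM x /= xr]; first exact: num_real.
  rewrite [leLHS]/Num.norm /= mx_normrE; apply: bigmax_le => [|i _].
    by apply: le_trans (ltW rM); rewrite sqrtr_ge0.
  rewrite (ord1 i.1); apply: le_trans (sqrt_coord_le x i.2) _.
  by apply: le_trans (ltW rM); rewrite ler_wsqrtr.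
apply: (@closed_comp _ _ (fun x : 'rV[R]_n => dot x x) [set y | y <= r]).
  by move=> x _; exact: dot_continuous.
exact: closed_le.
Qed.

Hypothesis kappa_ge0 : forall a, a \in Rp -> 0 <= kappa a.

(** At a point where [f x * exp (- K |x|)] is maximal on a ball, with
    [K > |xi|], the reflection terms only lower the radial derivative, so that
    it is too small for a point where [f] is positive. *)
Lemma euler_solution_le0 xi f : euler_solution xi f -> f 0 <= 0 ->
  forall x, f x <= 0.
Proof.
move=> [cf df] f00 x0; rewrite leNgt; apply/negP => fx0.
set K := Num.sqrt (dot xi xi) + 1.
have K0 : 0 < K by rewrite ltr_wpDl// sqrtr_ge0.
pose w x := f x * expR (- (K * Num.sqrt (dot x x))).
have cw : continuous w.
  move=> x; apply: (continuousM (cf x)).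
  apply: (@continuous_comp _ _ _ (fun x : 'rV[R]_n => dot x x)
    (fun r => expR (- (K * Num.sqrt r)))); first exact: dot_continuous.
  apply: continuous_comp; last exact: continuous_expR.
  by apply: cvgN; apply: cvgM; [exact: cvg_cst|exact: sqrt_continuous].
have [|c cA cmax] := compact_EVT_max _ (@compact_dot_ball (dot x0 x0)) (continuous_subspaceT cw).
  by exists x0 => /=.
rewrite inE/= in cA.
have fc : 0 < f c.
  have : w x0 <= w c by apply: cmax; rewrite inE/=.
  rewrite -(pmulr_lgt0 _ (expR_gt0 (- (K * Num.sqrt (dot c c))))); apply: lt_le_trans.
  by rewrite mulr_gt0// expR_gt0.
have c0 : c != 0 by apply: contraTneq fc => ->; rewrite -leNgt.
set rho := Num.sqrt (dot c c).
have rho0 : 0 < rho by rewrite sqrtr_gt0 lt_neqAle eq_sym dot_eq0 c0 dot_ge0.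
have /= [dfc dfE] := df c.
have Dle : 'D_c f c <= (K - 1) * rho * f c.
  rewrite dfE lerBlDr (@le_trans _ _ ((K - 1) * rho * f c))//.
    by rewrite ler_pM2r// /K addrK mulrC dot_cauchy.
  rewrite lerDl big_seq; apply: sumr_ge0 => a aR; rewrite mulr_ge0 ?kappa_ge0//.
  have : w (reflection a c) <= w c by apply: cmax; rewrite inE/= reflection_isom.
  by rewrite /w reflection_isom ler_pM2r ?expR_gt0// subr_ge0.
(* the maximality of [w] along the ray through [c] bounds the same derivative
   from below, by [1 - exp (- u) >= u / (1 + u)] *)
have Dge (h : R) : 0 < h < 1 ->
  K * rho * f c / (1 + K * h * rho) <= (- h)^-1 *: ((f \o shift c) (- h *: c) - f c).
  move=> /andP[h0 h1]; have h1' : 0 <= 1 - h by rewrite subr_ge0 ltW.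
  have hE : - h *: c + c = (1 - h) *: c by rewrite addrC scaleNr scalerBl scale1r.
  have sE : Num.sqrt (dot ((1 - h) *: c) ((1 - h) *: c)) = (1 - h) * rho.
    by rewrite dotZl dotZr mulrA -expr2 sqrtrM ?sqr_ge0// sqrtr_sqr ger0_norm.
  have : w ((1 - h) *: c) <= w c.
    apply: cmax; rewrite inE/= dotZl dotZr; apply: le_trans cA.
    rewrite mulrA ler_piMl ?dot_ge0// mulr_ile1// lerBlDr lerDl ltW//.
  rewrite /w sE /= hE -/rho => H.
  rewrite -[_ *: _]/(_ * _) invrN mulNr -mulrN opprB ler_pdivlMl//.
  have {}H : f ((1 - h) *: c) <= f c * expR (- (K * h * rho)).
    rewrite -(ler_pM2r (expR_gt0 (- (K * ((1 - h) * rho))))) -[leRHS]mulrA -expRD.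
    by apply: le_trans H _; rewrite ler_pM2l// ler_expR; lra.
  have u0 : 0 < 1 + K * h * rho by rewrite addr_gt0// !mulr_gt0.
  have He : expR (- (K * h * rho)) <= (1 + K * h * rho)^-1.
    by rewrite expRN lef_pV2 ?posrE ?expR_gt0 ?expR_ge1Dx.
  have -> : h * (K * rho * f c / (1 + K * h * rho)) = f c - f c / (1 + K * h * rho).
    by field; rewrite gt_eqF.
  by rewrite lerB//; apply: le_trans H _; rewrite ler_pM2l.
have Dlt : 'D_c f c < (K - 2^-1) * rho * f c.
  by apply: le_lt_trans Dle _; rewrite !ltr_pM2r//; lra.
have /nbhs_ballP[e /= e0 He] : nbhs (0 : R) (fun h => h != 0 ->
    h^-1 *: ((f \o shift c) (h *: c) - f c) < (K - 2^-1) * rho * f c).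
  exact: (cvgr_lt _ dfc _ Dlt).
(* [h] is in the neighbourhood, below 1, and small enough for
   [K / (1 + K * h * rho)] to exceed [K - 2^-1] *)
pose h : R := Num.min (e / 2) (Num.min 2^-1 (2 * K * K * rho)^-1).
have h0 : 0 < h by rewrite !lt_min divr_gt0//= !invr_gt0 ltr0n /= !mulr_gt0.
have he : h < e by rewrite gt_min ltr_pdivrMr// mulr_natr mulr2n ltrDl e0.
have h1 : h <= 2^-1 by rewrite !ge_min lexx orbT.
have hK : h * (2 * K * K * rho) <= 1.
  by rewrite -ler_pdivlMr ?mulr_gt0// mul1r !ge_min lexx !orbT.
have := He (- h); rewrite /ball/= sub0r opprK gtr0_norm// => /(_ he).
rewrite oppr_eq0 gt_eqF// => /(_ isT).
apply/negP; rewrite -leNgt; apply: le_trans (Dge h _); last by lra.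
rewrite ler_pdivlMr ?addr_gt0 ?mulr_gt0//.
rewrite [leLHS]mulrAC ler_pM2r// [leLHS]mulrAC ler_pM2r//.
have : h * (2 * K * K * rho) = 2 * (K * (K * h * rho)) by ring.
have : 0 < K * h * rho by rewrite !mulr_gt0.
nra.
Qed.

End euler.

(** * The Dunkl kernel *)

Section reflection_continuous.
Context {R : realType} {n : nat}.

Lemma dotl_continuous (a : 'rV[R]_n) : continuous (dot a).
Proof.
apply/rV_continuousP => x e e0; set L := dot (const_mx 1) (map_mx Num.norm a).
have L0 : 0 < L + 1 by rewrite ltr_wpDl// sumr_ge0// => i _; rewrite !mxE mulr_ge0.
exists (e / (L + 1)) => [|y]; first exact: divr_gt0.
rewrite ltr_pdivlMr// => xy; rewrite -dotNr -dotDr.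
apply: le_trans (dot_mxnorm _ _) _; apply: le_trans (ltW xy).
by rewrite mulrC ler_wpM2l// lerDl.
Qed.

Lemma reflection_continuous (a : 'rV[R]_n) : continuous (reflection a).
Proof.
move=> x.
have -> : reflection a = idfun - (fun x => (2 * dot a x / dot a a) *: a) by exact/funext.
apply: continuousB.
  exact: cvg_id.
apply: (@continuousZr_tmp _ _ _ (fun x => 2 * dot a x / dot a a)).
apply: (@continuousM _ _ (fun x => 2 * dot a x) (fun=> (dot a a)^-1)).
  apply: (@continuousM _ _ (fun=> 2) (dot a)); last exact: dotl_continuous.
  exact: cst_continuous.
exact: cst_continuous.
Qed.

End reflection_continuous.

Section euler_theory.
Context {R : realType} {n : nat}.
Variables (Rp : {fset 'rV[R]_n}) (kappa : 'rV[R]_n -> R).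
Hypothesis kappa_ge0 : forall a, a \in Rp -> 0 <= kappa a.
Implicit Types (x xi : 'rV[R]_n) (f : 'rV[R]_n -> R).
Local Notation euler_solution := (euler_solution Rp kappa).

Lemma euler_solutionN xi f : euler_solution xi f -> euler_solution xi (- f).
Proof.
move=> [cf df]; split=> [x|x]; first exact: (continuousN (cf x)).
have dfx := df x.
apply: is_derive_eq; rewrite -[(- f) x]/(- f x) opprB mulrN addrC; congr (_ + _).
by rewrite -sumrN; apply: eq_bigr => a _; rewrite -[(- f) _]/(- f _); ring.
Qed.

Lemma euler_solutionB xi f g : euler_solution xi f -> euler_solution xi g ->
  euler_solution xi (f - g).
Proof.
move=> [cf df] [cg dg]; split=> [x|x]; first exact: (continuousB (cf x) (cg x)).
have dfx := df x; have dgx := dg x.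
apply: is_derive_eq; rewrite -[(f - g) x]/(f x - g x) mulrBr.
set s := \sum_(a <- Rp) _; set s' := \sum_(a <- Rp) _; set s2 := \sum_(a <- Rp) _.
have -> : s2 = s - s'.
  by rewrite -sumrB; apply: eq_bigr => a _; rewrite -[(f - g) _]/(f _ - g _); ring.
by rewrite !opprB; ring.
Qed.

Lemma euler_solution_unique xi f g : euler_solution xi f -> euler_solution xi g ->
  f 0 = g 0 -> f =1 g.
Proof.
move=> ef eg fg0 x; apply/eqP; rewrite eq_le -subr_le0 -[_ <= f x]subr_le0.
apply/andP; split.
  apply: (euler_solution_le0 kappa_ge0 (euler_solutionB ef eg)).
  by rewrite -[(f - g) 0]/(f 0 - g 0) fg0 subrr.
apply: (euler_solution_le0 kappa_ge0 (euler_solutionB eg ef)).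
by rewrite -[(g - f) 0]/(g 0 - f 0) fg0 subrr.
Qed.

Lemma is_derive_dilation f x k D : is_derive (k *: x) (k *: x) f D ->
  is_derive x x (fun y => f (k *: y)) D.
Proof.
move=> [dD DE].
have E : (fun h : R => h^-1 *: (((fun y => f (k *: y)) \o shift x) (h *: x) - f (k *: x))) =
    (fun h : R => h^-1 *: ((f \o shift (k *: x)) (h *: (k *: x)) - f (k *: x))).
  by apply/funext => h /=; rewrite [k *: (_ + _)]scalerDr [k *: (h *: _)]scalerA mulrC -scalerA.
by split; rewrite /derivable /derive E.
Qed.

End euler_theory.

Section dunkl_kernel_properties.
Context {R : realType} {n : nat}.
Variables (Rp : {fset 'rV[R]_n}) (kappa : 'rV[R]_n -> R).
Hypothesis kappa_ge0 : forall a, a \in Rp -> 0 <= kappa a.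
Variable E : 'rV[R]_n -> 'rV[R]_n -> R.
Hypothesis hE : dunkl_kernel Rp kappa E.
Implicit Types (x xi y : 'rV[R]_n).
Local Notation euler_solution := (euler_solution Rp kappa).

Lemma row_mx_norm_le x y : `|row_mx x y| <= Num.max `|x| `|y|.
Proof.
rewrite [leLHS]/Num.norm /= mx_normrE; apply: bigmax_le => [|[i j] _ /=].
  by rewrite le_max normr_ge0.
rewrite (ord1 i) mxE; case: splitP => k _; rewrite le_max ler_coord_norm ?orbT//.
Qed.

Lemma dunkl_kernel_continuous_at x xi e : 0 < e -> exists2 d, 0 < d &
  forall y eta, `|x - y| < d -> `|xi - eta| < d -> `|E x xi - E y eta| <= e.
Proof.
move=> e0; have [an _ _] := hE.
have /rV_continuousP/(_ (row_mx x xi) _ e0)[d d0 H] := analytic_continuous an.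
exists d => // y eta xy xe; have := H (row_mx y eta).
rewrite !row_mxKl !row_mxKr; apply.
rewrite opp_row_mx add_row_mx; apply: le_lt_trans (row_mx_norm_le _ _) _.
by rewrite gt_max xy.
Qed.

Lemma dunkl_kernel_continuousl xi : continuous (E^~ xi).
Proof.
apply/rV_continuousP => x e /(dunkl_kernel_continuous_at x xi)[d d0 H].
by exists d => // y xy; apply: H; rewrite ?subrr ?normr0.
Qed.

Lemma dunkl_kernel_continuousr x : continuous (E x).
Proof.
apply/rV_continuousP => xi e /(dunkl_kernel_continuous_at x xi)[d d0 H].
by exists d => // y xy; apply: H; rewrite ?subrr ?normr0.
Qed.

Lemma dunkl_kernel_derive xi x :
  exists l, forall v, is_derive x v (E^~ xi) (dot l v).
Proof.
have [an _ _] := hE; have [l lP] := analytic_derive an (row_mx x xi).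
exists (lsubmx l) => v; have [D1 D2] := lP (row_mx v 0).
set F := fun z => _ in D1 D2.
have EF : (fun h : R => h^-1 *: ((E^~ xi \o shift x) (h *: v) - E x xi)) =
  (fun h : R => h^-1 *: ((F \o shift (row_mx x xi)) (h *: row_mx v 0) - F (row_mx x xi))).
  apply/funext => h; rewrite /F /= scale_row_mx add_row_mx !row_mxKl !row_mxKr.
  by rewrite scaler0 add0r.
have -> : dot (lsubmx l) v = dot l (row_mx v 0).
  rewrite -{2}(hsubmxK l) /dot big_split_ord/= [X in _ = _ + X]big1 ?addr0 => [|i _].
    by apply: eq_bigr => i _; rewrite !row_mxEl.
  by rewrite !row_mxEr !mxE mulr0.
by split; rewrite /derivable /derive EF.
Qed.

(** Contracting the eigenvalue equations with [x] turns the difference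
    quotients into differences, and the partial derivatives into the radial
    one. *)
Lemma dunkl_kernel_euler xi : euler_solution xi (E^~ xi).
Proof.
split=> [|x]; first exact: dunkl_kernel_continuousl.
have [l lP] := dunkl_kernel_derive xi x.
apply: is_derive_eq (lP x) _.
have [_ ev _] := hE.
have -> : dot x xi * E x xi = \sum_j x 0 j * dunkl_op Rp kappa j (E^~ xi) x.
  by rewrite /dot mulr_suml; apply: eq_bigr => j _; rewrite ev mulrA.
under eq_bigr do rewrite mulrDr mulr_sumr.
rewrite big_split/= exchange_big/= -addrA [X in _ + X](_ : _ = 0) ?addr0.
  apply: eq_bigr => j _; have [_ ->] := lP (delta_mx 0 j).
  rewrite mulrC; congr (_ * _); rewrite /dot (bigD1 j)//= big1 => [|i ij].
    by rewrite !mxE !eqxx mulr1 addr0.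
  by rewrite !mxE (negbTE ij) andbF mulr0.
rewrite -sumrB big1// => a _.
under eq_bigr do rewrite mulrA [_ * (_ * _)]mulrCA.
rewrite -mulr_suml -mulr_sumr -/(dot x a) -mulrA -mulrBr [X in _ * X](_ : _ = 0) ?mulr0//.
rewrite /reflection_quotient (dotC x); case: eqP => [ax|/eqP ax].
  by rewrite ax mul0r reflectionE// !subrr.
by rewrite mulrC divfK// subrr.
Qed.

Lemma dunkl_kernel_ge0 x xi : 0 <= E x xi.
Proof.
have h0 : (- E^~ xi) 0 <= 0 by rewrite -[leLHS]/(- E 0 xi); have [_ _ ->] := hE; rewrite oppr_le0.
have := euler_solution_le0 kappa_ge0 (euler_solutionN (dunkl_kernel_euler xi)) h0 x.
by rewrite -[leLHS]/(- E x xi) oppr_le0.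
Qed.

(** Both sides solve the radial equation for [k *: xi] and are 1 at the origin. *)
Lemma dunkl_kernelZ k x xi : E (k *: x) xi = E x (k *: xi).
Proof.
apply: (@euler_solution_unique _ _ _ _ kappa_ge0 (k *: xi)
  (fun x => E (k *: x) xi) (E^~ (k *: xi))); last first.
- by have [_ _ e0] := hE; rewrite scaler0 !e0.
- exact: dunkl_kernel_euler.
split=> y.
  apply: (@continuous_comp _ _ _ (fun x : 'rV[R]_n => k *: x) (E^~ xi)).
    exact: scaler_continuous.
  exact: dunkl_kernel_continuousl.
have H := is_derive_dilation (proj2 (dunkl_kernel_euler xi) (k *: y)).
apply: is_derive_eq H _; rewrite dotZl dotZr; congr (_ - _).
by apply: eq_bigr => a _; rewrite reflectionZ.
Qed.

Lemma dunkl_kernel0r x : E x 0 = 1.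
Proof. by rewrite -(scale0r 0) -dunkl_kernelZ scale0r; have [_ _ ->] := hE. Qed.

End dunkl_kernel_properties.

Section dunkl_kernel_symmetry.
Context {R : realType} {n : nat}.
Variables (Rt Rp : {fset 'rV[R]_n}) (kappa : 'rV[R]_n -> R).
Variable E : 'rV[R]_n -> 'rV[R]_n -> R.
Hypotheses (hRt : root_system Rt) (hRp : positive_roots Rt Rp)
  (hkappa : multiplicity_function Rt kappa) (hE : dunkl_kernel Rp kappa E).
Implicit Types (x xi y : 'rV[R]_n).
Local Notation euler_solution := (euler_solution Rp kappa).

Lemma positive_roots_sub a : a \in Rp -> a \in Rt.
Proof. by have [b [_ ->]] := hRp => /andP[]. Qed.

Lemma multiplicity_ge0 a : a \in Rp -> 0 <= kappa a.
Proof. by move=> /positive_roots_sub; have [+ _] := hkappa; apply. Qed.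

Lemma rootN a : a \in Rt -> - a \in Rt.
Proof. by move=> aR; have [_ _ h] := hRt; rewrite -scaleN1r h// eqxx orbT. Qed.

Lemma multiplicity_reflection a b : a \in Rt -> b \in Rt ->
  kappa (reflection a b) = kappa b.
Proof. by move=> aR bR; have [_ ->//] := hkappa; exact: refl_group_gen. Qed.

Lemma multiplicityN a : a \in Rt -> kappa (- a) = kappa a.
Proof.
move=> aR; rewrite -(multiplicity_reflection aR aR); congr kappa.
have [h _ _] := hRt; have a0 : dot a a != 0 by rewrite dot_eq0; apply: contraNneq h => <-.
by rewrite /reflection mulfK// -[X in X - _]scale1r -scalerBl -scaleN1r; congr (_ *: _); lra.
Qed.

(** A reflection permutes all the roots but not the positive ones, so the sum
    is first symmetrized over [Rt]. *)
Lemma sum_positive_roots_reflection (F : 'rV[R]_n -> R) a : a \in Rt ->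
  (forall b, b \in Rt -> F (- b) = F b) ->
  \sum_(b <- Rp) F (reflection a b) = \sum_(b <- Rp) F b.
Proof.
move=> aR FN.
have refR b : b \in Rt -> reflection a b \in Rt by move=> bR; have [_ h _] := hRt; exact: h.
have [v [v0 Rpv]] := hRp.
have half (G : 'rV[R]_n -> R) : (forall b, b \in Rt -> G (- b) = G b) ->
    \sum_(b <- Rt) G b = 2 * \sum_(b <- Rp) G b.
  move=> GN; rewrite (bigID (fun b => 0 < dot b v))/=.
  have -> : \sum_(b <- Rt | 0 < dot b v) G b = \sum_(b <- Rp) G b.
    rewrite -big_filter; apply: perm_big; apply: uniq_perm; rewrite ?filter_uniq// => b.
    by rewrite mem_filter andbC Rpv.
  have -> : \sum_(b <- Rt | ~~ (0 < dot b v)) G b = \sum_(b <- Rp) G b.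
    rewrite -big_filter.
    transitivity (\sum_(b <- map -%R Rp) G b).
      apply: perm_big; apply: uniq_perm; rewrite ?filter_uniq//.
        by rewrite (map_inj_uniq oppr_inj) fset_uniq.
      move=> b; rewrite mem_filter; apply/andP/mapP => [[bv bR]|[c + ->]].
        exists (- b); rewrite ?opprK// Rpv rootN//= dotNl oppr_gt0 lt_neqAle v0//=.
        by rewrite leNgt.
      by rewrite Rpv dotNl oppr_gt0 -leNgt => /andP[cR /ltW ->]; rewrite rootN.
    rewrite big_map big_seq [RHS]big_seq; apply: eq_bigr => b /positive_roots_sub bR.
    exact: GN.
  by rewrite mulr_natl mulr2n.
have two0 : 2 != 0 :> R by rewrite pnatr_eq0.
apply: (mulfI two0).
rewrite -!half//; last first.
  by move=> b bR; rewrite -(FN _ (refR _ bR)) -scaleN1r reflectionZ scaleN1r.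
rewrite -(big_map (reflection a) xpredT F); apply: perm_big; apply: uniq_perm; rewrite ?fset_uniq//.
  by rewrite (map_inj_uniq (inv_inj (@reflectionK _ _ a))) fset_uniq.
move=> b; apply/mapP/idP => [[c cR ->]|bR]; first exact: refR.
by exists (reflection a b); rewrite ?reflectionK ?refR.
Qed.

(** Conjugating by a reflection permutes the reflections in the roots and
    preserves the multiplicities, hence the radial equation. *)
Lemma dunkl_kernel_reflection a x xi : a \in Rp ->
  E (reflection a x) (reflection a xi) = E x xi.
Proof.
move=> /positive_roots_sub aR; set s := reflection a.
apply: (@euler_solution_unique _ _ _ _ multiplicity_ge0 xi
  (fun x => E (s x) (s xi)) (E^~ xi)); last 2 first.
- exact: (dunkl_kernel_euler hE).
- by have [_ _ e0] := hE; rewrite e0 /s /reflection dot0r mulr0 mul0r scale0r subrr e0.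
split=> y.
  apply: (@continuous_comp _ _ _ s (E^~ (s xi))); last exact: (dunkl_kernel_continuousl hE).
  exact: reflection_continuous.
have [_ /(_ (s y)) [dD DE]] := dunkl_kernel_euler hE (s xi).
have sE : (fun h : R =>
      h^-1 *: (((fun y => E (s y) (s xi)) \o shift y) (h *: y) - E (s y) (s xi))) =
    (fun h : R => h^-1 *: ((E^~ (s xi) \o shift (s y)) (h *: s y) - E (s y) (s xi))).
  by apply/funext => h; rewrite /= /s reflectionD reflectionZ.
split; rewrite /derivable /derive sE//; rewrite -/(derive _ _ _) DE /s reflection_isom.
congr (_ - _).
rewrite -(sum_positive_roots_reflection (a := a))//; last first.
  by move=> b bR; rewrite multiplicityN// reflectionN.
rewrite big_seq [RHS]big_seq; apply: eq_bigr => b /positive_roots_sub bR.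
by rewrite multiplicity_reflection// reflection_conj reflectionK.
Qed.

(** By homogeneity the radial derivative of [E x] is that of [E ^~ xi], so
    [E x] solves the same radial equation as [E ^~ x]. *)
Lemma dunkl_kernelC x xi : E x xi = E xi x.
Proof.
apply: (@euler_solution_unique _ _ _ _ multiplicity_ge0 x (E x) (E^~ x)); last 2 first.
- exact: (dunkl_kernel_euler hE).
- by rewrite (dunkl_kernel0r multiplicity_ge0 hE); have [_ _ ->] := hE.
split=> y; first exact: (dunkl_kernel_continuousr hE).
have [_ /(_ x) [dD DE]] := dunkl_kernel_euler hE y.
have sE : (fun h : R => h^-1 *: ((E x \o shift y) (h *: y) - E x y)) =
    (fun h : R => h^-1 *: ((E^~ y \o shift x) (h *: x) - E x y)).
  apply/funext => h /=; rewrite -[in LHS](scale1r y) scalerA mulr1 -scalerDl.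
  by rewrite -(dunkl_kernelZ multiplicity_ge0 hE) scalerDl !scale1r.
split; rewrite /derivable /derive sE//; rewrite -/(derive _ _ _) DE dotC.
congr (_ - _); rewrite big_seq [RHS]big_seq; apply: eq_bigr => b bR.
by rewrite -(dunkl_kernel_reflection (reflection b x) y bR) reflectionK.
Qed.

End dunkl_kernel_symmetry.

(** * Borel measurability *)

Section continuous_measurable.
Context {R : realType} {m : nat}.

Lemma measurable_rV_cube (q : 'rV[R]_m) (r : R) :
  measurable [set x : 'rV[R]_m | forall i, `|x 0 i - q 0 i| < r].
Proof.
rewrite (_ : mkset _ = \bigcap_(i in [set: 'I_m])
    rV_coord i @^-1` [set y | `|y - q 0 i| < r]); last first.
  by apply/seteqP; split=> [x H i _|x H i]; [exact: H|exact: (H i)].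
apply: fin_bigcap_measurable => // i _; rewrite -[X in measurable X]setTI.
apply: measurable_rV_coord => //.
rewrite (_ : mkset _ = `](q 0 i - r), (q 0 i + r)[%classic); first exact: measurable_itv.
by apply/seteqP; split=> y /=; rewrite in_itv/= ltr_distl.
Qed.

(** An open set is a countable union of rational cubes, so the product
    sigma-algebra contains the open sets. *)
Lemma continuous_measurable_rV (f : 'rV[R]_m -> R) : continuous f ->
  measurable_fun setT f.
Proof.
move=> /rV_continuousP cf; apply: (measurability _ (RGenOInfty.measurableE R)).
move=> _ [_ [a ->] <-]; rewrite setTI.
pose cube (q : 'rV[rat]_m) (k : nat) : set 'rV[R]_m :=
  [set x | forall i, `|x 0 i - ratr (q 0 i)| < k.+1%:R^-1].
pose U := f @^-1` `]a, +oo[%classic.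
rewrite -/U (_ : U = \bigcup_(qk : 'rV[rat]_m * nat)
    (if `[< cube qk.1 qk.2 `<=` U >] then cube qk.1 qk.2 else set0)); last first.
  apply/seteqP; split=> [x Ux|x [[q k] _]]; last by case: asboolP => // H /H.
  have fx : 0 < f x - a by move: Ux; rewrite /U/= in_itv/= andbT subr_gt0.
  have [d d0 Hd] := cf x ((f x - a) / 2) (divr_gt0 fx (ltr0n _ 2)).
  have [k kd] : exists k, k.+1%:R^-1 < d / 2.
    have [N _ HN] := near_infty_natSinv_lt (PosNum (divr_gt0 d0 (ltr0n R 2))).
    by exists N; exact: HN (leqnn N).
  have q_ i : exists q : rat, `|x 0 i - ratr q| < k.+1%:R^-1.
    have lt : x 0 i - k.+1%:R^-1 < x 0 i + k.+1%:R^-1 :> R.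
      by rewrite ltrD2l gtrN// invr_gt0.
    have [q] := rat_in_itvoo lt; rewrite in_itv/= => qx; exists q.
    by rewrite distrC ltr_distl.
  pose q := \row_i sval (cid (q_ i)).
  have xq : cube q k x by move=> i; rewrite mxE; case: cid.
  exists (q, k) => //=; rewrite ifT//; apply/asboolP => y yq.
  have : `|x - y| < d.
    apply: (@le_lt_trans _ _ (k.+1%:R^-1 + k.+1%:R^-1)); last first.
      by rewrite -mulr2n -[ltLHS]mulr_natr -ltr_pdivlMr.
    rewrite [leLHS]/Num.norm /= mx_normrE; apply: bigmax_le => [|[i j] _ /=].
      by rewrite addr_ge0// invr_ge0.
    rewrite (ord1 i) !mxE -(subrKA (ratr (q 0 j))); apply: le_trans (ler_normD _ _) _.
    by rewrite [X in _ + X <= _]distrC lerD// ltW.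
  move=> /Hd; rewrite ler_distl => /andP[_ H].
  by rewrite /U/= in_itv/= andbT; lra.
apply: countable_bigcupT_measurable => // -[q k] /=; case: asboolP => // _.
pose q' : 'rV[R]_m := \row_i ratr (q 0 i).
rewrite (_ : cube q k = [set x : 'rV[R]_m | forall i, `|x 0 i - q' 0 i| < k.+1%:R^-1]).
  exact: measurable_rV_cube.
by apply/seteqP; split=> x H i; have := H i; rewrite mxE.
Qed.

End continuous_measurable.

Section measurable_kernels.
Context {R : realType} {n : nat}.
Variables (Rp : {fset 'rV[R]_n}) (kappa : 'rV[R]_n -> R).

Lemma measurable_dot : measurable_fun [set: 'rV[R]_n] (fun x => dot x x).
Proof. apply: continuous_measurable_rV; exact: dot_continuous. Qed.

Lemma measurable_dunkl_weight : measurable_fun setT (dunkl_weight Rp kappa).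
Proof.
apply: measurable_prod => a _.
apply: (measurableT_comp (measurable_powR _)); apply: measurableT_comp => //.
apply: continuous_measurable_rV.
rewrite (_ : (fun x => dot x a) = dot a); first exact: dotl_continuous.
by apply/funext => x; rewrite dotC.
Qed.

Lemma dunkl_weight_ge0 x : 0 <= dunkl_weight Rp kappa x.
Proof. by apply: prodr_ge0 => a _; exact: powR_ge0. Qed.

Lemma measurable_row_mx :
  measurable_fun setT (fun p : 'rV[R]_n * 'rV[R]_n => row_mx p.1 p.2 : 'rV[R]_(n + n)).
Proof.
apply: measurable_fun_rVP => i; rewrite -(fintype.splitK i); case: (fintype.split i) => j /=.
  rewrite (_ : _ \o _ = rV_coord j \o fst).
    by apply: measurableT_comp; [exact: measurable_rV_coord|exact: measurable_fst].
  by apply/funext => p; rewrite /= /rV_coord row_mxEl.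
rewrite (_ : _ \o _ = rV_coord j \o snd).
  by apply: measurableT_comp; [exact: measurable_rV_coord|exact: measurable_snd].
by apply/funext => p; rewrite /= /rV_coord row_mxEr.
Qed.

Lemma measurable_heat_kernel E M t : dunkl_kernel Rp kappa E ->
  measurable_fun setT (fun p : 'rV[R]_n * 'rV[R]_n => heat_kernel Rp kappa E M t p.1 p.2).
Proof.
move=> hE; have md := measurable_dot.
apply: measurable_funM; last first.
  pose s : R := (Num.sqrt (2 * t))^-1.
  rewrite (_ : (fun p => _) = (fun z : 'rV[R]_(n + n) => E (lsubmx z) (rsubmx z)) \o
    (fun z => s *: z) \o (fun p : 'rV[R]_n * 'rV[R]_n => row_mx p.1 p.2)).
    apply: measurableT_comp; last exact: measurable_row_mx.
    apply: measurableT_comp.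
      by apply: continuous_measurable_rV; case: hE => an _ _; exact: analytic_continuous.
    apply: measurable_fun_rVP => i.
    rewrite (_ : _ \o _ = (fun x => s * rV_coord i x)); last first.
      by apply/funext => x; rewrite /= /rV_coord mxE.
    by apply: measurable_funM => //; exact: measurable_rV_coord.
  by apply/funext => p /=; rewrite scale_row_mx row_mxKl row_mxKr.
apply: measurable_funM => //; apply: measurableT_comp => //.
apply: measurable_funM => //; apply: measurableT_comp => //.
apply: measurable_funD.
  by apply: (measurableT_comp md); exact: measurable_fst.
by apply: (measurableT_comp md); exact: measurable_snd.
Qed.

End measurable_kernels.

(** * Lower bound for the Bessel function *)

Section bessel.
Context {R : realType}.
Implicit Types (nu z t : R).
Local Notation mu := (@lebesgue_measure R).

(** Real powers are measurable functions of the base, and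
    [x^-1 = x * (x ^+ 2)^-1] also at 0. *)
Lemma measurable_inv : measurable_fun [set: R] (@GRing.inv R).
Proof.
rewrite (_ : @GRing.inv R = (fun x => x * (x ^+ 2) `^ (-1))); last first.
  apply/funext => x; rewrite powR_inv1 ?sqr_ge0//; have [->|x0] := eqVneq x 0.
    by rewrite invr0 mul0r.
  by rewrite expr2 invfM mulrA mulfV// mul1r.
apply: measurable_funM => //; apply: (measurableT_comp (measurable_powR _)).
exact: measurable_funX.
Qed.

Definition bessel_integrand nu z t : R :=
  expR (- (t + z ^+ 2 / (4 * t))) * t `^ (- nu - 1).

Lemma bessel_integrand_ge0 nu z t : 0 <= bessel_integrand nu z t.
Proof. by rewrite mulr_ge0 ?expR_ge0 ?powR_ge0. Qed.

Lemma measurable_bessel_integrand nu :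
  measurable_fun setT (fun p : R * R => bessel_integrand nu p.1 p.2).
Proof.
apply: measurable_funM.
  apply: measurableT_comp => //; apply: measurableT_comp => //.
  apply: measurable_funD => //; apply: measurable_funM.
    by apply: measurable_funX; exact: measurable_fst.
  apply: (measurableT_comp measurable_inv).
  by apply: measurable_funM => //; exact: measurable_snd.
by apply: (measurableT_comp (measurable_powR _)); exact: measurable_snd.
Qed.

(** With [s = 1 / t] this is the boundedness of [exp (- k s) * s ^ a], which
    follows from a single term of the exponential series. *)
Lemma exp_inv_powR_bounded (k a : R) : 0 < k -> 0 <= a -> exists2 C, 0 <= C &
  forall t, 0 < t -> expR (- (k / t)) * t `^ (- a) <= C.
Proof.
move=> k0 a0; have [N aN] : exists N : nat, a <= N.+1%:R.
  by exists (Num.truncn a); apply: ltW; exact: truncnS_gt.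
pose C := N.+1`!%:R / k ^+ N.+1.
have C0 : 0 <= C by rewrite divr_ge0// exprn_ge0// ltW.
exists (1 + C) => [|t t0]; first by rewrite addr_ge0.
have ti0 : 0 < t^-1 by rewrite invr_gt0.
have -> : t `^ (- a) = t^-1 `^ a by rewrite -powR_inv1 ?(ltW t0)// -powRrM mulN1r.
have [t1|t1] := leP t^-1 1.
  rewrite (@le_trans _ _ 1)// ?lerDl// mulr_ile1 ?expR_ge0 ?powR_ge0//.
    by rewrite expR_le1 oppr_le0 divr_ge0 ?ltW.
  by rewrite -(powRr0 t^-1) ger_powR// ti0.
rewrite (@le_trans _ _ C)// ?lerDr//.
rewrite expRN ler_pdivrMl ?expR_gt0//.
have : t^-1 `^ a <= t^-1 ^+ N.+1.
  by rewrite -powR_mulrn ?(ltW ti0)// ler_powR// ltW.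
move=> /le_trans; apply.
have := @expR_ge1Dxn R (k / t) N (divr_ge0 (ltW k0) (ltW t0)).
move=> H; rewrite /C mulrC mulrAC ler_pdivlMr ?exprn_gt0//.
have f0 : 0 < N.+1`!%:R :> R by rewrite ltr0n fact_gt0.
rewrite mulrC -exprMn -ler_pdivrMl// mulrC; apply: le_trans H.
by rewrite lerDr.
Qed.

(** An infinite integral would be read as 0 in [besselK], so the lower
    bounds for it rest on this finiteness. *)
Lemma bessel_integral_lt_pinfty nu z : 0 < z -> -1 <= nu ->
  (\int[mu]_(t in `]0%R, +oo[) (bessel_integrand nu z t)%:E < +oo)%E.
Proof.
move=> z0 nu0.
have k0 : 0 < z ^+ 2 / 4 by rewrite divr_gt0// exprn_gt0.
have a0 : 0 <= nu + 1 by lra.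
have [C C0 HC] := exp_inv_powR_bounded k0 a0.
have mI : measurable_fun setT (bessel_integrand nu z).
  exact: (measurable_fun_pair2 z (measurable_bessel_integrand nu)).
have mE : measurable_fun setT (@exponential_pdf R 1) by exact: measurable_exponential_pdf.
apply: (@le_lt_trans _ _ (\int[mu]_(t in `]0%R, +oo[) (C%:E * (exponential_pdf 1 t)%:E))%E).
  apply: ge0_le_integral => //=.
  - by move=> t _; rewrite lee_fin bessel_integrand_ge0.
  - by apply/measurable_EFinP; exact: measurable_funTS.
  - apply: emeasurable_funM => //; apply/measurable_EFinP; exact: measurable_funTS.
  - move=> t; rewrite in_itv/= andbT => t0; rewrite -EFinM lee_fin.
    rewrite exponential_pdfE ?(ltW t0)// mul1r mulN1r /bessel_integrand opprD expRD.
    rewrite -mulrA [leRHS]mulrC ler_wpM2l ?expR_ge0//.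
    have := HC t t0; rewrite opprD.
    by rewrite (_ : z ^+ 2 / 4 / t = z ^+ 2 / (4 * t))// invfM mulrA.
apply: (@le_lt_trans _ _ (\int[mu]_t (C%:E * (exponential_pdf 1 t)%:E))%E).
  apply: ge0_subset_integral => //=.
    by apply: emeasurable_funM => //; exact/measurable_EFinP.
  by move=> t _; rewrite mule_ge0// lee_fin exponential_pdf_ge0.
rewrite ge0_integralZl_EFin//.
- by rewrite integral_exponential_pdf// mule1 ltry.
- by move=> t _; rewrite lee_fin exponential_pdf_ge0.
- exact/measurable_EFinP.
Qed.

(** The integral over a well chosen window on which the exponent is bounded is
    already of the right order. *)
Lemma besselKt_window nu z a b B : 0 < z -> -1 <= nu -> 0 < a -> a <= b ->
  (forall t, a <= t <= b -> t + z ^+ 2 / (4 * t) <= B) ->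
  z `^ nu * (2^-1 * (z / 2) `^ nu * ((b - a) * (expR (- B) * b `^ (- nu - 1))))
    <= besselKt nu z.
Proof.
move=> z0 nu0 a0 ab HB; rewrite /besselKt ler_wpM2l ?powR_ge0//.
rewrite /besselK ler_wpM2l ?mulr_ge0 ?powR_ge0//.
have mI : measurable_fun setT (bessel_integrand nu z).
  exact: (measurable_fun_pair2 z (measurable_bessel_integrand nu)).
have fin := bessel_integral_lt_pinfty z0 nu0.
rewrite /Rintegral -lee_fin fineK; last first.
  rewrite ge0_fin_numE//; apply: integral_ge0 => t _; rewrite lee_fin.
  exact: bessel_integrand_ge0.
apply: (@le_trans _ _ (\int[mu]_(t in `[a, b]) (bessel_integrand nu z t)%:E)%E); last first.
  apply: ge0_subset_integral => //=.
  - by apply/measurable_EFinP; exact: measurable_funTS.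
  - by move=> t _; rewrite lee_fin bessel_integrand_ge0.
  - by move=> t /=; rewrite !in_itv/= andbT => /andP[+ _]; exact: lt_le_trans.
have -> : ((b - a) * (expR (- B) * b `^ (- nu - 1)))%:E =
    (\int[mu]_(t in `[a, b]) (expR (- B) * b `^ (- nu - 1))%:E)%E.
  rewrite integral_cst//= lebesgue_measure_itv/= lte_fin lt_neqAle ab andbT.
  case: eqVneq => [->|_] /=; first by rewrite subrr mul0r mule0.
  by rewrite -EFinD -EFinM mulrC.
apply: ge0_le_integral => //=.
- by move=> t _; rewrite lee_fin mulr_ge0 ?expR_ge0 ?powR_ge0.
- by apply/measurable_EFinP; exact: measurable_funTS.
move=> t; rewrite in_itv/= => tab; rewrite lee_fin ler_pM ?expR_ge0 ?powR_ge0//.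
  by rewrite ler_expR lerN2 HB.
have t0 : 0 < t by case/andP: tab => at_ _; exact: lt_le_trans at_.
rewrite -opprD !powRN lef_pV2 ?posrE ?powR_gt0//; last by case/andP: tab => *; lra.
rewrite ge0_ler_powR// ?nnegrE ?(ltW t0)//; last by case/andP: tab.
- by rewrite -lerBlDr sub0r.
- by case/andP: tab => *; lra.
Qed.

(** The exponent [t + z ^+ 2 / (4 * t)] is minimal at [t = z / 2], with value [z],
    whence the window for large [z]; for small [z] the mass is at [t] of order
    [z ^+ 2]. *)
Lemma besselKt_ge nu : 1 <= nu ->
  exists2 c, 0 < c & forall z, 0 < z -> c * expR (- z) <= besselKt nu z.
Proof.
move=> nu1; have nu0 : -1 <= nu by lra.
pose p : R := - nu - 1.
pose c1 := 2^-1 * 2^-1 `^ nu * 2 `^ p * expR (- (9 / 4)).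
pose c2 := 2^-1 * 2^-1 `^ nu * (3 / 2) `^ p * expR (- 1).
have c10 : 0 < c1 by rewrite !mulr_gt0 ?powR_gt0 ?expR_gt0.
have c20 : 0 < c2 by rewrite !mulr_gt0 ?powR_gt0 ?expR_gt0.
exists (Num.min c1 c2) => [|z z0]; first by rewrite lt_min c10.
have z2 : 0 < z ^+ 2 by rewrite exprn_gt0.
have [z1|z1] := leP z 1.
  apply: (@le_trans _ _ c1).
    apply: (@le_trans _ _ (c1 * expR (- z))); first by rewrite ler_wpM2r ?expR_ge0// ge_min lexx.
    by rewrite ler_piMr ?(ltW c10)// expR_le1 oppr_le0 ltW.
  apply: le_trans (@besselKt_window nu z (z ^+ 2) (2 * z ^+ 2) (9 / 4) z0 nu0 z2 _ _).
  - rewrite powRM ?(ltW z0)// powRM ?(ltW z2)// -/p.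
    have H : z `^ nu * z `^ nu * z ^+ 2 * (z ^+ 2) `^ p = 1.
      rewrite -powR_mulrn ?(ltW z0)// -powRrM -!powRD ?(gt_eqF z0) ?implybT//.
      by rewrite (_ : _ + _ = 0) ?powRr0// /p; ring.
    rewrite le_eqVlt; apply/orP; left; apply/eqP.
    rewrite -[LHS]mulr1 -[X in _ * X]H /c1; set e := expR _; set l := 2 `^ p.
    by ring.
  - lra.
  - move=> t /andP[zt tz]; have t0 : 0 < t by exact: lt_le_trans zt.
    have : z ^+ 2 / (4 * t) <= 4^-1.
      by rewrite ler_pdivrMr ?mulr_gt0// mulrA mulVf// mul1r.
    have : z ^+ 2 <= 1 by rewrite exprn_ile1// ltW.
    lra.
apply: (@le_trans _ _ (c2 * expR (- z))); first by rewrite ler_wpM2r ?expR_ge0// ge_min lexx orbT.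
apply: le_trans (@besselKt_window nu z (z / 2) (z / 2 + 1) (z + 1) z0 nu0 _ _ _).
- have H : 1 <= z `^ nu * z `^ nu * z `^ p.
    rewrite -!powRD ?(gt_eqF z0) ?implybT// -(powRr0 z) ler_powR ?(ltW z1)// /p; lra.
  have Hp : (3 / 2) `^ p * z `^ p <= (z / 2 + 1) `^ p.
    rewrite -powRM ?(ltW z0)// /p -opprD !powRN lef_pV2 ?posrE ?powR_gt0 ?mulr_gt0//; last lra.
    by rewrite ge0_ler_powR ?nnegrE; lra.
  rewrite powRM ?(ltW z0)// addrAC subrr add0r mul1r opprD expRD /c2 -/p.
  set e := expR (-1); set e' := expR (- z); set k := 2^-1 `^ nu.
  set q := (_ / _) `^ p in Hp *; set x := z `^ nu in H *; set y := z `^ p in H Hp.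
  have ke : 0 <= 2^-1 * k * (e' * e) by rewrite !mulr_ge0 ?powR_ge0 ?expR_ge0.
  have x0 : 0 <= x * x by rewrite mulr_ge0 ?powR_ge0.
  have q0 : 0 <= q by exact: powR_ge0.
  have : q <= x * x * (z / 2 + 1) `^ p.
    apply: le_trans (ler_wpM2l x0 Hp); rewrite mulrCA ler_peMr//.
  move=> /(ler_wpM2l ke) Hf; apply: (@le_trans _ _ (2^-1 * k * (e' * e) * q)).
    by rewrite le_eqVlt; apply/orP; left; apply/eqP; ring.
  by apply: le_trans Hf _; rewrite le_eqVlt; apply/orP; left; apply/eqP; ring.
- by rewrite divr_gt0.
- by rewrite lerDl.
- move=> t /andP[zt tz]; have t0 : 0 < t by apply: lt_le_trans zt; rewrite divr_gt0.
  rewrite -lerBrDl ler_pdivrMr ?mulr_gt0//; nra.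
Qed.

Lemma measurable_besselKt nu : measurable_fun setT (@besselKt R nu).
Proof.
apply: measurable_funM => //; apply: measurable_funM.
  apply: measurable_funM => //.
  by apply: (measurableT_comp (measurable_powR _)); exact: measurable_funM.
apply: (measurableT_comp (f := fine)) => //.
pose f (p : R * R) : \bar R :=
  ((fun q : R * R => (bessel_integrand nu q.1 q.2)%:E) \_ [set q | 0 < q.2]) p.
rewrite (_ : (fun z => _) = (fun z => \int[mu]_t f (z, t))%E); last first.
  apply/funext => z; rewrite integral_mkcond; apply: eq_integral => t _.
  rewrite /f !patchE; congr (if _ then _ else _).
  by apply/idP/idP; rewrite !inE/= in_itv/= andbT.
apply: (@measurable_fun_fubini_tonelli_F _ _ _ _ _ mu f); last first.
  by move=> p; apply: erestrict_ge0 => q _; rewrite lee_fin bessel_integrand_ge0.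
apply/measurable_restrict => //.
  rewrite (_ : mkset _ = snd @^-1` `]0, +oo[%classic).
    by rewrite -[X in measurable X]setTI; exact: measurable_snd.
  by apply/seteqP; split=> q /=; rewrite in_itv/= andbT.
apply: measurable_funTS; apply/measurable_EFinP; exact: measurable_bessel_integrand.
Qed.

End bessel.

(** * Gaussians and the heat kernel *)

Section heat.
Context {R : realType} {n : nat}.
Variables (Rt Rp : {fset 'rV[R]_n}) (kappa : 'rV[R]_n -> R).
Variables (E : 'rV[R]_n -> 'rV[R]_n -> R) (M : R).
Hypotheses (hRt : root_system Rt) (hRp : positive_roots Rt Rp)
  (hkappa : multiplicity_function Rt kappa) (hE : dunkl_kernel Rp kappa E)
  (hM : heat_normalized Rp kappa E M).
Implicit Types (x y : 'rV[R]_n) (t : R).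

Local Notation mu := (lebesgue_rV n : {sigma_finite_measure set 'rV[R]_n -> \bar R}).
Local Notation nu := (n%:R / 2 + gamma_kappa Rp kappa).
Local Notation h2 := (dunkl_weight Rp kappa).
Local Notation Gamma := (heat_kernel Rp kappa E M).

(** The heat kernel with pole at the origin, where the Dunkl kernel is 1. *)
Definition gaussian (t : R) x : R := M * t `^ (- nu) * expR (- (dot x x / (4 * t))).

Lemma heat_kernel0 t x : Gamma t 0 x = gaussian t x.
Proof.
by rewrite /heat_kernel /gaussian scaler0 dot0l add0r mulNr; have [_ _ ->] := hE; rewrite mulr1.
Qed.

Lemma measurable_gaussian t : measurable_fun setT (gaussian t).
Proof.
apply: measurable_funM => //; apply: measurableT_comp => //.
apply: measurableT_comp => //; apply: measurable_funM => //; exact: measurable_dot.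
Qed.

Lemma gaussian_mass t : 0 < t -> (\int[mu]_x (gaussian t x * h2 x)%:E = 1)%E.
Proof.
by move=> t0; rewrite -[RHS](hM 0 t0); apply: eq_integral => x _; rewrite heat_kernel0.
Qed.

Lemma heat_constant_gt0 : 0 < M.
Proof.
rewrite ltNge; apply/negP => M0.
have := gaussian_mass ltr01; rewrite /gaussian powR1 mulr1.
pose g x := - M * expR (- (dot x x / (4 * 1))) * h2 x.
have g0 x : 0 <= g x.
  by rewrite /g mulr_ge0 ?dunkl_weight_ge0// mulr_ge0 ?expR_ge0// oppr_ge0.
under eq_integral => x _.
  rewrite (_ : (_ * _)%:E = - (g x)%:E)%E; last by rewrite -EFinN /g !mulNr opprK.
  over.
rewrite integral_ge0N => [H|x _]; last by rewrite lee_fin.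
have : (0 <= \int[mu]_x (g x)%:E)%E by apply: integral_ge0 => x _; rewrite lee_fin.
by rewrite -oppe_le0 H lee_fin ler10.
Qed.

Lemma gaussian_gt0 t x : 0 < t -> 0 < gaussian t x.
Proof.
by move=> t0; rewrite !mulr_gt0 ?expR_gt0 ?powR_gt0//; exact: heat_constant_gt0.
Qed.

Lemma heat_kernel_ge0 t x y : 0 <= Gamma t x y.
Proof.
rewrite !mulr_ge0 ?expR_ge0 ?powR_ge0//; first exact/ltW/heat_constant_gt0.

exact: (dunkl_kernel_ge0 (multiplicity_ge0 hRp hkappa) hE).
Qed.

(** Completing the square, with the homogeneity and the symmetry of the Dunkl
    kernel, turns the product into a heat kernel at another time and point. *)
Lemma gaussian_heat_kernel t x y : 0 < t ->
  gaussian 1 x * Gamma t x y =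
  gaussian (1 + t) y * Gamma (t / (1 + t)) ((1 + t)^-1 *: y) x.
Proof.
move=> t0; have k0 := multiplicity_ge0 hRp hkappa.
have t1 : 0 < 1 + t by rewrite addr_gt0.
have s0 : 0 < t / (1 + t) by rewrite divr_gt0.
have t2 : 0 <= 2 * t by rewrite mulr_ge0// ltW.
have s2 : 0 <= 2 * (t / (1 + t)) by rewrite mulr_ge0// ltW.
have ZZ (a b : R) : E (a *: x) (b *: y) = E ((a * b) *: x) y.
  by rewrite mulrC -scalerA -(dunkl_kernelZ k0 hE).
have sq (a : R) : 0 <= a -> (Num.sqrt a)^-1 * (Num.sqrt a)^-1 = a^-1.
  by move=> a0; rewrite -invfM -expr2 sqr_sqrtr.
have -> : Gamma (t / (1 + t)) ((1 + t)^-1 *: y) x = M * (t / (1 + t)) `^ (- nu) *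
    expR (- (dot y y / (1 + t) ^+ 2 + dot x x) / (4 * (t / (1 + t)))) *
    E ((2 * t)^-1 *: x) y.
  have dE : dot ((1 + t)^-1 *: y) ((1 + t)^-1 *: y) = dot y y / (1 + t) ^+ 2.
    by rewrite dotZl dotZr; field; rewrite gt_eqF.
  rewrite /heat_kernel (dunkl_kernelC hRt hRp hkappa hE) scalerA ZZ dE.
  rewrite [(Num.sqrt _)^-1 * (_ / _)]mulrA sq//.
  have -> : (2 * (t / (1 + t)))^-1 / (1 + t) = (2 * t)^-1.
    by field; rewrite !gt_eqF.
  by [].
rewrite /heat_kernel ZZ sq// /gaussian powR1 mulr1.
have -> : t `^ (- nu) = (1 + t) `^ (- nu) * (t / (1 + t)) `^ (- nu).
  by rewrite -powRM ?ltW// [(1 + t) * _]mulrC divfK ?gt_eqF.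
set e := E _ _; set p1 := (1 + t) `^ _; set p2 := _ `^ _.
transitivity (M * M * p1 * p2 * e *
  (expR (- (dot x x / (4 * 1))) * expR (- (dot x x + dot y y) / (4 * t)))); first by ring.
transitivity (M * M * p1 * p2 * e * (expR (- (dot y y / (4 * (1 + t)))) *
  expR (- (dot y y / (1 + t) ^+ 2 + dot x x) / (4 * (t / (1 + t)))))); last by ring.
rewrite -!expRD; congr (_ * expR _); field.
by rewrite !gt_eqF.
Qed.

(** The factor which depends on [x] is a heat kernel, of mass one. *)
Lemma gaussian_evolution t y : 0 < t ->
  (\int[mu]_x (gaussian 1 x * Gamma t x y * h2 x)%:E = (gaussian (1 + t) y)%:E)%E.
Proof.
move=> t0; have t1 : 0 < 1 + t by rewrite addr_gt0.
have s0 : 0 < t / (1 + t) by rewrite divr_gt0.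
under eq_integral do rewrite gaussian_heat_kernel// -mulrA EFinM.
rewrite ge0_integralZl_EFin//; last 3 first.
- by move=> x _; rewrite lee_fin mulr_ge0 ?dunkl_weight_ge0 ?heat_kernel_ge0.
- apply/measurable_EFinP; apply: measurable_funM; last exact: measurable_dunkl_weight.
  exact: (measurable_fun_pair2 _ (measurable_heat_kernel M _ hE)).
- exact/ltW/gaussian_gt0.
by rewrite hM// mule1.
Qed.

(** Completing the square, while a fraction [eta] of the exponent is kept back
    for integrability. *)
Lemma gaussian_exp_le (b eta t : R) x : 0 < t -> 0 < eta < 1 ->
  gaussian t x * expR (b * Num.sqrt (dot x x)) <=
  eta `^ (- nu) * expR (b ^+ 2 * t / (1 - eta)) * gaussian (t / eta) x.
Proof.
move=> t0 /andP[eta0 eta1]; have M0 := heat_constant_gt0.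
have e1 : 0 < 1 - eta by rewrite subr_gt0.
rewrite /gaussian powRM ?invr_ge0 ?(ltW t0) ?(ltW eta0)//.
have -> : eta^-1 `^ (- nu) = eta `^ nu.
  by rewrite -powR_inv1 ?(ltW eta0)// -powRrM mulN1r opprK.
have H : eta `^ (- nu) * eta `^ nu = 1.
  by rewrite -powRD ?(gt_eqF eta0) ?implybT// [- _ + _]addNr powRr0.
set r := Num.sqrt (dot x x); have rr : dot x x = r ^+ 2 by rewrite sqr_sqrtr// dot_ge0.
rewrite -mulrA -expRD.
have -> : eta `^ (- nu) * expR (b ^+ 2 * t / (1 - eta)) *
   (M * (t `^ (- nu) * eta `^ nu) * expR (- (dot x x / (4 * (t / eta))))) =
   (eta `^ (- nu) * eta `^ nu) * (M * t `^ (- nu) *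
    (expR (b ^+ 2 * t / (1 - eta)) * expR (- (dot x x / (4 * (t / eta)))))) by ring.
rewrite H mul1r -expRD ler_wpM2l ?mulr_ge0 ?powR_ge0 ?(ltW M0)//.
rewrite ler_expR rr -subr_ge0.
have -> : b ^+ 2 * t / (1 - eta) + - (r ^+ 2 / (4 * (t / eta))) -
    (- (r ^+ 2 / (4 * t)) + b * r) =
    ((1 - eta) * r - 2 * b * t) ^+ 2 / (4 * t * (1 - eta)).
  by field; rewrite !gt_eqF.
by rewrite divr_ge0 ?sqr_ge0// !mulr_ge0// ltW.
Qed.

Lemma gaussian_exp_integral (b eta t : R) : 0 < t -> 0 < eta < 1 ->
  (\int[mu]_x (gaussian t x * expR (b * Num.sqrt (dot x x)) * h2 x)%:E <=
   (eta `^ (- nu) * expR (b ^+ 2 * t / (1 - eta)))%:E)%E.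
Proof.
move=> t0 eta01; have te0 : 0 < t / eta by case/andP: eta01 => *; rewrite divr_gt0.
rewrite -[leRHS]mule1 -(gaussian_mass te0) -ge0_integralZl_EFin//; last 3 first.
- by move=> x _; rewrite lee_fin mulr_ge0 ?dunkl_weight_ge0// ltW// gaussian_gt0.
- apply/measurable_EFinP; apply: measurable_funM; last exact: measurable_dunkl_weight.
  exact: measurable_gaussian.
- by rewrite mulr_ge0 ?powR_ge0 ?expR_ge0.
apply: ge0_le_integral => //.
- by move=> x _; rewrite lee_fin mulr_ge0 ?dunkl_weight_ge0// mulr_ge0 ?expR_ge0// ltW// gaussian_gt0.
- apply/measurable_EFinP; apply: measurable_funM; last exact: measurable_dunkl_weight.
  apply: measurable_funM; first exact: measurable_gaussian.
  apply: measurableT_comp => //; apply: measurable_funM => //.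
  apply: (measurableT_comp (continuous_measurable_fun (@sqrt_continuous R))).
  exact: measurable_dot.
- apply: emeasurable_funM => //; apply/measurable_EFinP.
  by apply: measurable_funM; [exact: measurable_gaussian|exact: measurable_dunkl_weight].
- move=> x _; rewrite -EFinM lee_fin mulrA ler_wpM2r ?dunkl_weight_ge0//.
  exact: gaussian_exp_le.
Qed.

Lemma lebesgue_rV_origin : (0 < n)%N -> mu [set 0] = 0%E.
Proof.
move=> n0; have -> : [set 0] = [set x : 'rV[R]_n | forall i, [set (0:R)] (x 0 i)].
  apply/seteqP; split=> x /= => [-> i|H]; first by rewrite mxE.
  by apply/rowP => i; rewrite mxE.
apply: (eq_trans (@lebesgue_rV_box R n (fun=> [set (0 : R)]) _)) => [i|].
  exact: measurable_set1.
by rewrite (bigD1 (Ordinal n0))//= lebesgue_measure_set1 mul0e.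
Qed.

End heat.

(** * Pairing Gaussians with the weighted space *)

Lemma measurable_rV_origin {R : realType} {n : nat} : measurable [set (0 : 'rV[R]_n)].
Proof.
rewrite (_ : [set 0] = \bigcap_(i in [set: 'I_n]) rV_coord i @^-1` [set (0 : R)]).
  apply: fin_bigcap_measurable => // i _; rewrite -[X in measurable X]setTI.
  by apply: measurable_rV_coord => //; exact: measurable_set1.
apply/seteqP; split=> [x -> i _|x H]; first by rewrite /= /rV_coord mxE.
by apply/rowP => i; rewrite mxE; exact: H.
Qed.

Section pairing.
Context {R : realType} {n : nat}.
Variables (Rt Rp : {fset 'rV[R]_n}) (kappa : 'rV[R]_n -> R).
Variables (E : 'rV[R]_n -> 'rV[R]_n -> R) (M rho p c : R).
Hypotheses (hn : (2 <= n)%N) (hRp : positive_roots Rt Rp)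
  (hkappa : multiplicity_function Rt kappa) (hE : dunkl_kernel Rp kappa E)
  (hM : heat_normalized Rp kappa E M) (hrho : 0 < rho) (hp : 1 <= p)
  (hp2 : p != 2) (hc : c < rho ^+ 2 * (1 - gamma_p p ^+ 2)).
Implicit Types (x y : 'rV[R]_n) (t : R).

Local Notation mu := (lebesgue_rV n : {sigma_finite_measure set 'rV[R]_n -> \bar R}).
Local Notation nu := (n%:R / 2 + gamma_kappa Rp kappa).
Local Notation h2 := (dunkl_weight Rp kappa).
Local Notation w := (rho_kappa_weight Rp kappa rho p).
Local Notation gaussian := (gaussian Rp kappa M).

(** The density of the weight with respect to [h2]. *)
Definition bessel_weight x : R :=
  besselKt nu (rho * Num.sqrt (dot x x)) `^ (gamma_p p * p).

Lemma bessel_weight_ge0 x : 0 <= bessel_weight x.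
Proof. exact: powR_ge0. Qed.

Lemma measurable_rV_norm : measurable_fun [set: 'rV[R]_n] (fun x => Num.sqrt (dot x x)).
Proof.
apply: (measurableT_comp (continuous_measurable_fun (@sqrt_continuous R))).
exact: measurable_dot.
Qed.

Lemma measurable_bessel_weight : measurable_fun setT bessel_weight.
Proof.
apply: (measurableT_comp (measurable_powR _)).
apply: (measurableT_comp (measurable_besselKt _)).
by apply: measurable_funM => //; exact: measurable_rV_norm.
Qed.

Lemma measurable_rho_kappa_weight : measurable_fun setT w.
Proof.
apply: measurable_funM; first exact: measurable_bessel_weight.
exact: measurable_dunkl_weight.
Qed.

Lemma rho_kappa_weight_ge0 x : 0 <= w x.
Proof. by rewrite mulr_ge0 ?powR_ge0 ?dunkl_weight_ge0. Qed.

Lemma bessel_order_ge1 : 1 <= nu.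
Proof.
have : 0 <= gamma_kappa Rp kappa.
  rewrite /gamma_kappa big_seq; apply: sumr_ge0 => a.
  exact: (multiplicity_ge0 hRp hkappa).
have : 2 <= n%:R :> R by rewrite ler_nat.
lra.
Qed.

Lemma gamma_p_gt0 : 0 < gamma_p p.
Proof.
have p0 : p != 0 by rewrite gt_eqF// (lt_le_trans ltr01).
rewrite /gamma_p normr_gt0 subr_eq0; apply: contraNneq hp2 => h.
by rewrite -[2](divfK p0) h mul1r.
Qed.

Lemma bessel_weight_lower_bound : exists2 k, 0 < k & forall x, x != 0 ->
  k * expR (- (rho * gamma_p p * p * Num.sqrt (dot x x))) <= bessel_weight x.
Proof.
have [k k0 Hk] := besselKt_ge bessel_order_ge1.
have q0 : 0 <= gamma_p p * p by rewrite mulr_ge0 ?(ltW gamma_p_gt0)// (le_trans ler01).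
exists (k `^ (gamma_p p * p)) => [|x x0]; first exact: powR_gt0.
have r0 : 0 < rho * Num.sqrt (dot x x).
  by rewrite mulr_gt0// sqrtr_gt0 lt_neqAle eq_sym dot_eq0 x0 dot_ge0.
have := Hk _ r0; move=> /(ge0_ler_powR q0); rewrite !nnegrE => H.
have e0 := expR_ge0 (- (rho * Num.sqrt (dot x x))).
have {}H := H (mulr_ge0 (ltW k0) e0) (le_trans (mulr_ge0 (ltW k0) e0) (Hk _ r0)).
apply: le_trans H; rewrite powRM ?(ltW k0)// -expRM.
by rewrite le_eqVlt; apply/orP; left; apply/eqP; congr (_ * expR _); ring.
Qed.

(** At the points where [a <= exp (b r)] the first term suffices; elsewhere
    [a <= a ^ p * exp (- b (p - 1) r)], which against a weight decaying like
    [exp (- b p r)] only asks of the other factor to decay like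
    [exp (- b r)]. *)
Lemma split_at_exponential (a b r : R) : 0 <= a ->
  a <= expR (b * r) + a `^ p * expR (- (b * (p - 1) * r)).
Proof.
move=> a0; have [ab|ab] := leP a (expR (b * r)).
  by rewrite (le_trans ab)// lerDl mulr_ge0 ?powR_ge0 ?expR_ge0.
rewrite (@le_trans _ _ (a `^ p * expR (- (b * (p - 1) * r))))// ?lerDr ?expR_ge0//.
have a1 : 0 < a by exact: lt_trans (expR_gt0 _) ab.
rewrite -{1}(powRr1 a0) [X in _ `^ X <= _](_ : 1 = p + (1 - p)); last by ring.
rewrite powRD ?(gt_eqF a1) ?implybT// ler_wpM2l ?powR_ge0// expRN -opprB powRN.
rewrite lef_pV2 ?posrE ?powR_gt0 ?expR_gt0//.
have -> : b * (p - 1) * r = b * r * (p - 1) by ring.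
by rewrite expRM ge0_ler_powR ?nnegrE ?expR_ge0 ?subr_ge0// ltW.
Qed.

(** [C2] bounds the exponential moment of the damped Gaussian, and [C1] the
    quotient of the damped Gaussian times [exp (- b (p - 1) r)] by the Bessel
    part of the weight. *)
Lemma gaussian_pairing_bound : exists C1 C2 : R, [/\ 0 <= C1, 0 <= C2 &
  forall t (U : 'rV[R]_n -> R), 0 <= t -> (forall x, 0 <= U x) ->
    measurable_fun setT U ->
    (\int[mu]_x (expR (- t * (rho ^+ 2 - c)) * gaussian (1 + t) x * U x * h2 x)%:E
      <= C2%:E + C1%:E * \int[mu]_x (U x `^ p * w x)%:E)%E].
Proof.
have M0 := heat_constant_gt0 hE hM.
have nu1 := bessel_order_ge1.
set b := rho * gamma_p p; set d := rho ^+ 2 - c.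
have b0 : 0 < b by rewrite mulr_gt0// gamma_p_gt0.
have bd : b ^+ 2 < d by rewrite /b /d exprMn; have := hc; lra.
have d0 : 0 < d by apply: le_lt_trans bd; rewrite sqr_ge0.
have [k k0 Hk] := bessel_weight_lower_bound.
rewrite -/b in Hk; clearbody b d.
pose q := b ^+ 2 / d.
have q1 : q < 1 by rewrite ltr_pdivrMr// mul1r.
have q0 : 0 <= q by rewrite divr_ge0 ?sqr_ge0// ltW.
(* [1 - eta] is the midpoint of [q] and 1, so that [b ^+ 2 / (1 - eta) <= d] *)
pose eta := (1 - q) / 2.
have eta01 : 0 < eta < 1 by rewrite /eta; lra.
have eta1 : 0 < 1 - eta by case/andP: eta01; rewrite subr_gt0.
have bdeta : b ^+ 2 / (1 - eta) <= d.
  by rewrite ler_pdivrMr// mulrC -ler_pdivrMr// -/q /eta; lra.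
pose C1 := M * expR (b ^+ 2) / k.
pose C2 := eta `^ (- nu) * expR (b ^+ 2 / (1 - eta)).
have C10 : 0 <= C1 by rewrite !mulr_ge0 ?expR_ge0 ?invr_ge0// ltW.
have C20 : 0 <= C2 by rewrite !mulr_ge0 ?expR_ge0 ?powR_ge0.
exists C1, C2; split => // t U t0 U0 mU.
have t1 : 0 < 1 + t by rewrite ltr_wpDr.
have G0 x := gaussian_gt0 hE hM x t1.
set e := expR (- t * d); have e0 : 0 <= e by exact: expR_ge0.
have mw := measurable_rho_kappa_weight.
have mh := measurable_dunkl_weight Rp kappa.
have mg := measurable_gaussian Rp kappa M (1 + t).
have mUp : measurable_fun setT (fun x => U x `^ p).
  exact: (measurableT_comp (measurable_powR _)).
pose F x := gaussian (1 + t) x * expR (b * Num.sqrt (dot x x)) * h2 x.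
have F0 x : 0 <= F x.
  by rewrite mulr_ge0 ?dunkl_weight_ge0// mulr_ge0 ?expR_ge0// ltW.
have mF : measurable_fun setT F.
  apply: measurable_funM => //; apply: measurable_funM => //.
  apply: measurableT_comp => //; apply: measurable_funM => //.
  exact: measurable_rV_norm.
have main x : x != 0 -> e * gaussian (1 + t) x * U x * h2 x <=
    e * F x + C1 * (U x `^ p * w x).
  move=> x0; set r := Num.sqrt (dot x x).
  have rr : dot x x = r ^+ 2 by rewrite sqr_sqrtr// dot_ge0.
  have Ge : e * gaussian (1 + t) x <= M * expR (b ^+ 2) * expR (- (b * r)).
    rewrite /gaussian mulrCA -!mulrA ler_wpM2l ?(ltW M0)//.
    have p1 : (1 + t) `^ (- nu) <= 1.
      by rewrite -[leRHS](powRr0 (1 + t)) ler_powR ?lerDl// oppr_le0 (le_trans ler01).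
    apply: (@le_trans _ _ (1 * (e * expR (- (dot x x / (4 * (1 + t))))))).
      by rewrite ler_wpM2r// mulr_ge0 ?expR_ge0.
    rewrite mul1r -!expRD ler_expR rr.
    have -> : - (r ^+ 2 / (4 * (1 + t))) =
       - (b * r) + b ^+ 2 * (1 + t) - (r - 2 * b * (1 + t)) ^+ 2 / (4 * (1 + t)).
      by field; rewrite gt_eqF.
    set Q := _ / (4 * (1 + t)); have Q0 : 0 <= Q.
      by rewrite divr_ge0 ?sqr_ge0// mulr_ge0// ltW.
    have := ler_wpM2l t0 (ltW bd); lra.
  have Us := split_at_exponential b r (U0 x).
  have eG0 : 0 <= e * gaussian (1 + t) x by rewrite mulr_ge0// ltW.
  rewrite /F; move: (gaussian (1 + t) x) Ge eG0 => g Ge eG0.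
  rewrite /rho_kappa_weight -/(bessel_weight x) !mulrA -mulrDl.
  rewrite ler_wpM2r ?dunkl_weight_ge0//.
  apply: le_trans (ler_wpM2l eG0 Us) _; rewrite mulrDr lerD//.
  have Up : 0 <= U x `^ p * expR (- (b * (p - 1) * r)).
    by rewrite mulr_ge0 ?powR_ge0 ?expR_ge0.
  apply: le_trans (ler_wpM2r Up Ge) _.
  have -> : M * expR (b ^+ 2) * expR (- (b * r)) *
      (U x `^ p * expR (- (b * (p - 1) * r))) =
      C1 * U x `^ p * (k * (expR (- (b * r)) * expR (- (b * (p - 1) * r)))).
    by rewrite /C1; field; rewrite gt_eqF.
  rewrite ler_wpM2l ?(mulr_ge0 C10) ?powR_ge0// -expRD.
  apply: le_trans (Hk x x0); rewrite ler_wpM2l ?(ltW k0)// ler_expR -/r; lra.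
apply: (@le_trans _ _ (\int[mu]_x (e%:E * (F x)%:E + C1%:E * (U x `^ p * w x)%:E))%E).
  apply: ae_ge0_le_integral => //.
  - by move=> x _; rewrite lee_fin mulr_ge0 ?dunkl_weight_ge0// mulr_ge0// mulr_ge0// ltW.
  - apply/measurable_EFinP; do 2 (apply: measurable_funM => //).
    exact: measurable_funM.
  - move=> x _; rewrite -!EFinM -EFinD lee_fin addr_ge0//.
    by rewrite mulr_ge0.
  by rewrite mulr_ge0// mulr_ge0 ?powR_ge0// rho_kappa_weight_ge0.
  - apply: emeasurable_funD; apply: emeasurable_funM => //; apply/measurable_EFinP => //.
    exact: measurable_funM.
  (* at the origin [besselKt] evaluates to 0 and the pointwise bound may fail *)
  exists [set 0]; split.
  - exact: measurable_rV_origin.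
  - by apply: lebesgue_rV_origin; exact: leq_trans hn.
  - move=> x /= H; apply: contrapT => x0; apply: H => _.
    by rewrite -!EFinM -EFinD lee_fin main//; exact/eqP.
rewrite ge0_integralD//; last 4 first.
- by move=> x _; rewrite -EFinM lee_fin mulr_ge0.
- by apply: emeasurable_funM => //; exact/measurable_EFinP.
- by move=> x _; rewrite -EFinM lee_fin mulr_ge0// mulr_ge0 ?powR_ge0// rho_kappa_weight_ge0.
- by apply: emeasurable_funM => //; apply/measurable_EFinP; exact: measurable_funM.
rewrite !ge0_integralZl_EFin//; last 4 first.
- by move=> x _; rewrite lee_fin mulr_ge0 ?powR_ge0// rho_kappa_weight_ge0.
- by apply/measurable_EFinP; exact: measurable_funM.
- by move=> x _; rewrite lee_fin.
- exact/measurable_EFinP.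
apply: leeD => //.
apply: le_trans (lee_wpmul2l _ (gaussian_exp_integral hE hM b t1 eta01)) _.
  by rewrite lee_fin.
rewrite -EFinM lee_fin mulrCA /C2 ler_wpM2l ?powR_ge0// -expRD ler_expR.
have -> : b ^+ 2 * (1 + t) / (1 - eta) = b ^+ 2 / (1 - eta) + t * (b ^+ 2 / (1 - eta)).
  by field; rewrite gt_eqF.
have := ler_wpM2l t0 bdeta; lra.
Qed.

End pairing.

(** * Gaussian means along the semigroup *)

Section complex_modulus.
Context {R : realType}.
Implicit Types z : R[i].

Lemma normc_sqrt z : normc z = Num.sqrt (complex.Re z ^+ 2 + complex.Im z ^+ 2).
Proof. by case: z. Qed.

Lemma normc_ge0 z : 0 <= normc z.
Proof. by rewrite normc_sqrt sqrtr_ge0. Qed.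

Lemma normr_Re_le z : `|complex.Re z| <= normc z.
Proof. by rewrite normc_sqrt -sqrtr_sqr ler_wsqrtr// lerDl sqr_ge0. Qed.

Lemma normr_Im_le z : `|complex.Im z| <= normc z.
Proof. by rewrite normc_sqrt -sqrtr_sqr ler_wsqrtr// lerDr sqr_ge0. Qed.

Lemma normc_le_ReIm z : normc z <= `|complex.Re z| + `|complex.Im z|.
Proof.
rewrite normc_sqrt -[leRHS]ger0_norm ?addr_ge0// -sqrtr_sqr ler_wsqrtr//.
rewrite sqrrD !real_normK ?num_real// addrAC lerDl mulrn_wge0// mulr_ge0//.
Qed.

Lemma measurable_normc d (T : measurableType d) (f : T -> R[i]) :
  measurable_fun setT (fun x => complex.Re (f x)) ->
  measurable_fun setT (fun x => complex.Im (f x)) ->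
  measurable_fun setT (fun x => normc (f x)).
Proof.
move=> mr mi; under eq_fun do rewrite normc_sqrt.
apply: (measurableT_comp (continuous_measurable_fun (@sqrt_continuous R))).
by apply: measurable_funD; exact: measurable_funX.
Qed.

End complex_modulus.

Section kernel_integral.
Context d1 d2 (X : measurableType d1) (Y : measurableType d2) {R : realType}.
Variables (m : {sigma_finite_measure set Y -> \bar R}) (k : X * Y -> R).
Hypothesis mk : measurable_fun setT k.

(** The integral is the difference of those of the positive and the negative
    part, each of which is measurable by Tonelli. *)
Lemma measurable_Rintegral_section :
  measurable_fun setT (fun x => \int[m]_y k (x, y)).
Proof.
apply: (measurableT_comp (f := fine)) => //.
have mkE : measurable_fun setT (EFin \o k) by exact/measurable_EFinP.
pose kp q := maxe (k q)%:E 0%E; pose kn q := maxe (- (k q)%:E)%E 0%E.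
rewrite (_ : (fun x => _) = (fun x => \int[m]_y kp (x, y) - \int[m]_y kn (x, y))%E).
  apply: emeasurable_funB.
    apply: (@measurable_fun_fubini_tonelli_F _ _ _ _ _ m kp) => [|q].
      exact: measurable_maxe.
    by rewrite le_max lexx orbT.
  apply: (@measurable_fun_fubini_tonelli_F _ _ _ _ _ m kn) => [|q].
    by apply: measurable_maxe => //; exact: measurableT_comp.
  by rewrite le_max lexx orbT.
by apply/funext => x; rewrite integralE; congr (_ - _)%E; apply: eq_integral => y _;
  rewrite ?funeposE ?funenegE.
Qed.

(** An infinite integral is read as the real number 0, so the bound survives. *)
Lemma le_normr_Rintegral_section (h : Y -> R) x :
  (forall y, `|k (x, y)| <= h y) -> measurable_fun setT h ->
  (`|\int[m]_y k (x, y)|%:E <= \int[m]_y (h y)%:E)%E.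
Proof.
move=> kh mh; have mkx := measurable_fun_pair2 x mk.
apply: (@le_trans _ _ `|\int[m]_y (k (x, y))%:E|%E).
  by rewrite /Rintegral; case: (integral _ _ _) => [r| |] /=; rewrite ?normr0 ?leey.
apply: le_trans (le_abse_integral m measurableT _) _; first exact/measurable_EFinP.
apply: ge0_le_integral => //.
- by apply: measurableT_comp => //; exact/measurable_EFinP.
- exact/measurable_EFinP.
- by move=> y _; rewrite lee_fin.
Qed.

End kernel_integral.

Section semigroup.
Context {R : realType} {n : nat}.
Variables (Rt Rp : {fset 'rV[R]_n}) (kappa : 'rV[R]_n -> R).
Variables (E : 'rV[R]_n -> 'rV[R]_n -> R) (M rho c : R).
Hypotheses (hRt : root_system Rt) (hRp : positive_roots Rt Rp)
  (hkappa : multiplicity_function Rt kappa) (hE : dunkl_kernel Rp kappa E)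
  (hM : heat_normalized Rp kappa E M).
Implicit Types (x y : 'rV[R]_n) (t : R) (f : 'rV[R]_n -> R[i]).

Local Notation mu := (lebesgue_rV n : {sigma_finite_measure set 'rV[R]_n -> \bar R}).
Local Notation h2 := (dunkl_weight Rp kappa).
Local Notation Gamma := (heat_kernel Rp kappa E M).
Local Notation gaussian := (gaussian Rp kappa M).
Local Notation T := (shifted_semigroup Rp kappa E M rho c).

(** The seminorm that stays bounded along orbits. *)
Definition gaussian_mean f : \bar R :=
  (\int[mu]_x (gaussian 1 x * normc (f x) * h2 x)%:E)%E.

Let kernel t (g : 'rV[R]_n -> R) (q : 'rV[R]_n * 'rV[R]_n) : R :=
  Gamma t q.1 q.2 * h2 q.2 * g q.2.

Let measurable_kernel t g : measurable_fun setT g -> measurable_fun setT (kernel t g).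
Proof.
move=> mg; apply: measurable_funM.
  apply: measurable_funM; first exact: measurable_heat_kernel.
  by apply: (measurableT_comp (measurable_dunkl_weight _ _)); exact: measurable_snd.
by apply: (measurableT_comp mg); exact: measurable_snd.
Qed.

Lemma shifted_semigroup_Re t f x : t != 0 -> complex.Re (T t f x) =
  expR (- t * (rho ^+ 2 - c)) * \int[mu]_y kernel t (fun y => complex.Re (f y)) (x, y).
Proof.
move=> t0; rewrite /shifted_semigroup (negbTE t0)/= mul0r subr0; congr (_ * _).
by apply: eq_Rintegral => y _; rewrite /kernel; case: (f y) => a b /=; rewrite mul0r subr0.
Qed.

Lemma shifted_semigroup_Im t f x : t != 0 -> complex.Im (T t f x) =
  expR (- t * (rho ^+ 2 - c)) * \int[mu]_y kernel t (fun y => complex.Im (f y)) (x, y).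
Proof.
move=> t0; rewrite /shifted_semigroup (negbTE t0)/= mul0r addr0; congr (_ * _).
by apply: eq_Rintegral => y _; rewrite /kernel; case: (f y) => a b /=; rewrite mul0r addr0.
Qed.

Lemma measurable_shifted_semigroup t f :
  measurable_fun setT (fun x => complex.Re (f x)) ->
  measurable_fun setT (fun x => complex.Im (f x)) ->
  measurable_fun setT (fun x => complex.Re (T t f x)) /\
  measurable_fun setT (fun x => complex.Im (T t f x)).
Proof.
move=> mr mi; have [->|t0] := eqVneq t 0; first by rewrite /shifted_semigroup eqxx.
split.
  under eq_fun do rewrite shifted_semigroup_Re//.
  apply: measurable_funM => //; apply: measurable_Rintegral_section.
  exact: measurable_kernel.
under eq_fun do rewrite shifted_semigroup_Im//.
apply: measurable_funM => //; apply: measurable_Rintegral_section.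
exact: measurable_kernel.
Qed.

(** The factor 2 comes from treating real and imaginary parts separately. *)
Lemma normc_shifted_semigroup_le t f x : 0 < t ->
  measurable_fun setT (fun x => complex.Re (f x)) ->
  measurable_fun setT (fun x => complex.Im (f x)) ->
  ((normc (T t f x))%:E <= (2 * expR (- t * (rho ^+ 2 - c)))%:E *
     \int[mu]_y (kernel t (fun y => normc (f y)) (x, y))%:E)%E.
Proof.
move=> t0 mr mi; have tn0 : t != 0 by rewrite gt_eqF.
have mN := measurable_normc mr mi.
set e := expR _; have e0 : 0 <= e by exact: expR_ge0.
have K0 y : 0 <= Gamma t x y * h2 y.
  by rewrite mulr_ge0 ?dunkl_weight_ge0// (heat_kernel_ge0 hRp hkappa hE hM).
have mK := measurable_fun_pair2 x (measurable_kernel t mN).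
apply: (@le_trans _ _ (`|complex.Re (T t f x)| + `|complex.Im (T t f x)|)%:E).
  by rewrite lee_fin normc_le_ReIm.
rewrite shifted_semigroup_Re// shifted_semigroup_Im// -/e !normrM (ger0_norm e0).
have I0 : (0 <= \int[mu]_y (kernel t (fun y => normc (f y)) (x, y))%:E)%E.
  by apply: integral_ge0 => y _; rewrite lee_fin mulr_ge0 ?normc_ge0.
rewrite -mulrDr EFinM EFinD [(2 * e)%R]mulrC EFinM -muleA lee_wpmul2l ?lee_fin//.
rewrite mule_natl mule2n.
apply: leeD; apply: le_normr_Rintegral_section => //.
- exact: measurable_kernel.
- move=> y; rewrite normrM ger0_norm//; apply: ler_wpM2l => //; exact: normr_Re_le.
- exact: measurable_kernel.
- move=> y; rewrite normrM ger0_norm//; apply: ler_wpM2l => //; exact: normr_Im_le.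
Qed.

(** By Tonelli, the Gaussian mean of the evolved function is at most twice the
    mean of the initial one against the evolved Gaussian. *)
Lemma gaussian_mean_shifted_semigroup t f : 0 <= t ->
  measurable_fun setT (fun x => complex.Re (f x)) ->
  measurable_fun setT (fun x => complex.Im (f x)) ->
  (gaussian_mean (T t f) <= 2%:E *
    \int[mu]_x (expR (- t * (rho ^+ 2 - c)) * gaussian (1 + t) x * normc (f x) * h2 x)%:E)%E.
Proof.
rewrite le_eqVlt => /predU1P[<-|t0] mr mi.
  rewrite /gaussian_mean /shifted_semigroup eqxx addr0.
  under [in leRHS]eq_integral do rewrite oppr0 mul0r expR0 mul1r.
  apply: lee_pemull; last by rewrite lee_fin ler1n.
  apply: integral_ge0 => x _; rewrite lee_fin mulr_ge0 ?dunkl_weight_ge0//.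
  by rewrite mulr_ge0 ?normc_ge0// ltW// (gaussian_gt0 hE hM).
have mN := measurable_normc mr mi.
have [mTr mTi] := measurable_shifted_semigroup t mr mi.
have mTN := measurable_normc mTr mTi.
have mg := measurable_gaussian Rp kappa M.
have mh := measurable_dunkl_weight Rp kappa.
have g0 x : 0 <= gaussian 1 x by rewrite ltW// (gaussian_gt0 hE hM).
have h0 x : 0 <= h2 x by exact: dunkl_weight_ge0.
set e := expR _; have e0 : 0 <= e by exact: expR_ge0.
have K0 x y : 0 <= kernel t (fun y => normc (f y)) (x, y).
  by rewrite mulr_ge0 ?normc_ge0// mulr_ge0// (heat_kernel_ge0 hRp hkappa hE hM).
have mK := measurable_kernel t mN.
pose F (q : 'rV[R]_n * 'rV[R]_n) : \bar R :=
  (gaussian 1 q.1 * h2 q.1 * kernel t (fun y => normc (f y)) q)%:E.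
have F0 q : (0 <= F q)%E by case: q => x y; rewrite lee_fin mulr_ge0// mulr_ge0.
have mF : measurable_fun setT F.
  apply/measurable_EFinP; apply: measurable_funM => //; apply: measurable_funM.
    by apply: (measurableT_comp (mg 1)); exact: measurable_fst.
  by apply: (measurableT_comp mh); exact: measurable_fst.
have FE x : (\int[mu]_y F (x, y) = (gaussian 1 x * h2 x)%:E *
    \int[mu]_y (kernel t (fun y => normc (f y)) (x, y))%:E)%E.
  rewrite -ge0_integralZl_EFin//.
  - by move=> y _; rewrite lee_fin.
  - by apply/measurable_EFinP; exact: (measurable_fun_pair2 x mK).
  - by rewrite mulr_ge0.
apply: (@le_trans _ _ (\int[mu]_x ((2 * e)%:E * \int[mu]_y F (x, y)))%E).
  apply: ge0_le_integral => //.
  - by move=> x _; rewrite lee_fin mulr_ge0// mulr_ge0 ?normc_ge0.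
  - apply/measurable_EFinP; apply: measurable_funM => //; exact: measurable_funM.
  - apply: emeasurable_funM => //; exact: measurable_fun_fubini_tonelli_F.
  - move=> x _; rewrite FE muleCA mulrAC EFinM.
    apply: lee_wpmul2l; first by rewrite lee_fin (mulr_ge0 (g0 x)).
    exact: normc_shifted_semigroup_le.
rewrite ge0_integralZl_EFin//; last 3 first.
- by move=> x _; exact: integral_ge0.
- exact: measurable_fun_fubini_tonelli_F.
- by rewrite mulr_ge0.
rewrite fubini_tonelli// EFinM -muleA lee_wpmul2l ?lee_fin//.
rewrite -ge0_integralZl_EFin//; last 2 first.
- by move=> y _; apply: integral_ge0.
- exact: measurable_fun_fubini_tonelli_G.
apply: ge0_le_integral => //.
- by move=> y _; rewrite mule_ge0 ?lee_fin//; exact: integral_ge0.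
- by apply: emeasurable_funM => //; exact: measurable_fun_fubini_tonelli_G.
- apply/measurable_EFinP; apply: measurable_funM => //; apply: measurable_funM => //.
  exact: measurable_funM.
move=> y _; rewrite -mulrA -mulrA EFinM lee_wpmul2l ?lee_fin//.
have FG : (\int[mu]_x F (x, y) = \int[mu]_x ((normc (f y) * h2 y)%:E *
    (gaussian 1 x * Gamma t x y * h2 x)%:E))%E.
  apply: eq_integral => x _.
  by rewrite /F /kernel/= -EFinM; congr EFin; ring.
rewrite FG.
rewrite ge0_integralZl_EFin//; last 3 first.
- move=> x _; rewrite lee_fin mulr_ge0// mulr_ge0//.
  by rewrite (heat_kernel_ge0 hRp hkappa hE hM).
- apply/measurable_EFinP; apply: measurable_funM => //; apply: measurable_funM => //.
  exact: (measurable_fun_pair1 y (measurable_heat_kernel M t hE)).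
- by rewrite mulr_ge0 ?normc_ge0.
by rewrite (gaussian_evolution hRt hRp hkappa hE hM)// -EFinM lee_fin mulrC.
Qed.

End semigroup.

(** * Failure of hypercyclicity *)

Section unbounded_orbits.
Context {R : realType} {n : nat}.
Variables (Rt Rp : {fset 'rV[R]_n}) (kappa : 'rV[R]_n -> R).
Variables (E : 'rV[R]_n -> 'rV[R]_n -> R) (M rho p c : R).
Hypotheses (hn : (2 <= n)%N) (hRt : root_system Rt) (hRp : positive_roots Rt Rp)
  (hkappa : multiplicity_function Rt kappa) (hE : dunkl_kernel Rp kappa E)
  (hM : heat_normalized Rp kappa E M) (hrho : 0 < rho) (hp : 1 <= p)
  (hp2 : p != 2) (hc : c < rho ^+ 2 * (1 - gamma_p p ^+ 2)).
Implicit Types (x : 'rV[R]_n) (t : R) (f : 'rV[R]_n -> R[i]).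

Local Notation mu := (lebesgue_rV n : {sigma_finite_measure set 'rV[R]_n -> \bar R}).
Local Notation h2 := (dunkl_weight Rp kappa).
Local Notation w := (rho_kappa_weight Rp kappa rho p).
Local Notation gaussian := (gaussian Rp kappa M).
Local Notation mean := (gaussian_mean Rp kappa M).
Local Notation T := (shifted_semigroup Rp kappa E M rho c).
Local Notation Lp := (Lp_space w p).
Local Notation norm := (Lp_norm w p).

Let p0 : 0 < p. Proof. exact: lt_le_trans hp. Qed.
Let g0 x : 0 <= gaussian 1 x. Proof. by rewrite ltW// (gaussian_gt0 hE hM). Qed.
Let h0 x : 0 <= h2 x. Proof. exact: dunkl_weight_ge0. Qed.

Let power_mass f : \bar R := (\int[mu]_x (normc (f x) `^ p * w x)%:E)%E.

Let power_mass_ge0 f : (0 <= power_mass f)%E.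
Proof.
by apply: integral_ge0 => x _; rewrite lee_fin mulr_ge0 ?powR_ge0 ?rho_kappa_weight_ge0.
Qed.

Lemma mean_add_le f1 f2 :
  measurable_fun setT (fun x => normc (f1 x)) ->
  measurable_fun setT (fun x => normc (f2 x)) ->
  measurable_fun setT (fun x => normc ((f1 - f2) x)) ->
  (mean f2 <= mean f1 + mean (f1 - f2)%R)%E.
Proof.
move=> m1 m2 m12.
have mg : measurable_fun setT (gaussian 1) := measurable_gaussian Rp kappa M 1.
have mh := measurable_dunkl_weight Rp kappa.
have mm f : measurable_fun setT (fun x => normc (f x)) ->
    measurable_fun setT (fun x => (gaussian 1 x * normc (f x) * h2 x)%:E).
  by move=> mf; apply/measurable_EFinP; apply: measurable_funM => //; exact: measurable_funM.
have pos f x : (0 <= (gaussian 1 x * normc (f x) * h2 x)%:E)%E.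
  by rewrite lee_fin mulr_ge0// mulr_ge0 ?normc_ge0.
rewrite /gaussian_mean -ge0_integralD//; [|exact: mm|exact: mm].
apply: ge0_le_integral => //; first exact: mm.
  by apply: emeasurable_funD; exact: mm.
move=> x _; rewrite -EFinD lee_fin -mulrDl -mulrDr ler_wpM2r// ler_wpM2l//.
rewrite -[f2 x](subKr (f1 x)); apply: le_trans (le_normcD _ _) _.
by rewrite normcN.
Qed.

Let phi x : R := expR (- (dot x x / (4 * 1))) / (1 + bessel_weight Rp kappa rho p x).

Let phi_den x : 1 <= 1 + bessel_weight Rp kappa rho p x.
Proof. by rewrite lerDl bessel_weight_ge0. Qed.

Let phi_gt0 x : 0 < phi x.
Proof. by rewrite divr_gt0 ?expR_gt0// (lt_le_trans ltr01). Qed.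

Let phi_le1 x : phi x <= 1.
Proof.
rewrite ler_pdivrMr ?(lt_le_trans ltr01)// mul1r; apply: le_trans (phi_den x).
by rewrite expR_le1 oppr_le0 divr_ge0 ?dot_ge0// mulr_ge0.
Qed.

Let measurable_phi : measurable_fun setT phi.
Proof.
apply: measurable_funM.
  apply: measurableT_comp => //; apply: measurableT_comp => //.
  by apply: measurable_funM => //; exact: measurable_dot.
apply: (measurableT_comp measurable_inv); apply: measurable_funD => //.
exact: measurable_bessel_weight.
Qed.

Let test (A : R) x : R[i] := (A * phi x)%:C%C.

Let normc_test A x : 0 <= A -> normc (test A x) = A * phi x.
Proof.
move=> A0; rewrite normc_sqrt /= expr0n addr0 sqrtr_sqr ger0_norm// mulr_ge0//.
exact: ltW.
Qed.

(** With [k] the Bessel part of the weight, [phi ^ p * k <= phi * k] is at most a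
    Gaussian, whatever the growth of [k]. *)
Let test_Lp A : 0 <= A -> Lp (test A).
Proof.
move=> A0; have M0 := heat_constant_gt0 hE hM.
have mA : measurable_fun setT (fun x => A * phi x) by exact: measurable_funM.
split; [exact: mA|exact: (measurable_cst (0 : R))|].
rewrite /Lp_norm poweR_lty//; apply: (@le_lt_trans _ _ ((A `^ p / M)%:E)); last exact: ltry.
have mg : measurable_fun setT (gaussian 1) := measurable_gaussian Rp kappa M 1.
have mh := measurable_dunkl_weight Rp kappa.
rewrite -[leRHS]mule1 -(gaussian_mass hE hM ltr01) -ge0_integralZl_EFin//; last 3 first.
- by move=> x _; rewrite lee_fin mulr_ge0.
- by apply/measurable_EFinP; exact: measurable_funM.
- by rewrite divr_ge0 ?powR_ge0// ltW.
apply: ge0_le_integral => //.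
- by move=> x _; rewrite lee_fin mulr_ge0 ?powR_ge0 ?rho_kappa_weight_ge0.
- apply/measurable_EFinP; apply: measurable_funM; last exact: measurable_rho_kappa_weight.
  apply: (measurableT_comp (measurable_powR _)).
  by under eq_fun do rewrite normc_test//.
- apply: emeasurable_funM => //; apply/measurable_EFinP; exact: measurable_funM.
move=> x _; rewrite normc_test// powRM ?(ltW (phi_gt0 _))// -EFinM lee_fin.
rewrite -!mulrA ler_wpM2l ?powR_ge0// /rho_kappa_weight -/(bessel_weight _ _ _ _ x).
rewrite mulrA /gaussian powR1 mulr1 !mulrA mulVf ?gt_eqF// mul1r ler_wpM2r//.
apply: (@le_trans _ _ (phi x * bessel_weight Rp kappa rho p x)).
  by rewrite ler_wpM2r ?bessel_weight_ge0// ge1r_powR// phi_gt0 phi_le1.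
rewrite mul1r /phi mulr1 [leLHS]mulrAC -[leLHS]mulrA ler_piMr ?expR_ge0// ler_pdivrMr ?(lt_le_trans ltr01)//.
by rewrite mul1r lerDr.
Qed.

Let test_mean : \bar R := (\int[mu]_x (gaussian 1 x * phi x * h2 x)%:E)%E.

Let mean_test A : 0 <= A -> (mean (test A) = A%:E * test_mean)%E.
Proof.
move=> A0; rewrite /test_mean -ge0_integralZl_EFin//.
- by apply: eq_integral => x _; rewrite normc_test// -EFinM; congr EFin; ring.
- by move=> x _; rewrite lee_fin mulr_ge0// mulr_ge0// ltW.
- apply/measurable_EFinP; apply: measurable_funM; last exact: measurable_dunkl_weight.
  by apply: measurable_funM => //; exact: measurable_gaussian.
Qed.

(** [phi] is positive, and the Gaussian has mass one. *)
Let test_mean_gt0 : (0 < test_mean)%E.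
Proof.
have mg : measurable_fun setT (gaussian 1) := measurable_gaussian Rp kappa M 1.
have mh := measurable_dunkl_weight Rp kappa.
have pos x : 0 <= gaussian 1 x * phi x * h2 x by rewrite mulr_ge0// mulr_ge0// ltW.
rewrite lt_neqAle; apply/andP; split; last by apply: integral_ge0 => x _; rewrite lee_fin.
apply/eqP => z.
have : (\int[mu]_x `|(gaussian 1 x * phi x * h2 x)%:E| = 0)%E.
  by rewrite z; apply: eq_integral => x _; rewrite gee0_abs// lee_fin.
move=> /ae_eq_integral_abs -/(_ measurableT) H.
have : (\int[mu]_x (gaussian 1 x * h2 x)%:E = \int[mu]_x (cst 0 x))%E.
  apply: ae_eq_integral => //.
    by apply/measurable_EFinP; exact: measurable_funM.
  apply: filterS (H _) => [x /= Hx _|].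
    have /eqP := Hx I; rewrite eqe mulf_eq0 mulf_eq0 (gt_eqF (phi_gt0 x)) orbF -mulf_eq0.
    by move=> /eqP ->.
  by apply/measurable_EFinP; apply: measurable_funM => //; exact: measurable_funM.
rewrite integral0 (gaussian_mass hE hM ltr01) => /eqP.
by rewrite eqe oner_eq0.
Qed.

(** The case [t = 0] of the pairing bound. *)
Lemma mean_small_norm C1 C2 f : 0 <= C1 ->
  (forall t (U : 'rV[R]_n -> R), 0 <= t -> (forall x, 0 <= U x) ->
    measurable_fun setT U ->
    (\int[mu]_x (expR (- t * (rho ^+ 2 - c)) * gaussian (1 + t) x * U x * h2 x)%:E
      <= C2%:E + C1%:E * \int[mu]_x (U x `^ p * w x)%:E)%E) ->
  measurable_fun setT (fun x => normc (f x)) ->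
  (norm f < 1%:E)%E -> (mean f <= (C2 + C1)%:E)%E.
Proof.
move=> C10 HC mf nf.
have J1 : (power_mass f <= 1%:E)%E.
  have -> : power_mass f = ((power_mass f `^ p^-1) `^ p)%E.
    by rewrite -poweRrM mulVf ?lt0r_neq0// poweRe1.
  have := nf; rewrite -/(norm f) /Lp_norm -/(power_mass f).
  have := poweR_ge0 (power_mass f) p^-1.
  case: (power_mass f `^ p^-1)%E => [r r0 r1| |]//; rewrite poweR_EFin lee_fin.
  rewrite lee_fin in r0; rewrite lte_fin in r1.
  have e1 : 1 `^ p = 1 :> R by rewrite powR1.
  by rewrite -e1 (ge0_ler_powR (ltW p0)) ?nnegrE// ltW.
have := HC 0 (fun x => normc (f x)) (lexx 0) (fun x => normc_ge0 (f x)) mf.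
rewrite oppr0 mul0r expR0 addr0.
rewrite (_ : (\int[mu]_x _)%E = mean f); last first.
  by apply: eq_integral => x _; rewrite mul1r.
move=> /le_trans; apply; rewrite EFinD leeD//.
by rewrite -[leRHS]mule1 lee_wpmul2l ?lee_fin.
Qed.

(** A multiple of the test function is at distance less than one from the orbit,
    so its mean is at most the bound [B] for the orbit plus the bound [C2 + C1]
    for the unit ball. *)
Lemma not_hypercyclic : ~ hypercyclic_on_Lp Rp kappa E M rho p c.
Proof.
move=> [v [mr mi vfin] dense].
have [C1 [C2 [C10 C20 HC]]] := gaussian_pairing_bound hn hRp hkappa hE hM hrho hp hp2 hc.
have mv := measurable_normc mr mi.
have Jfin : power_mass v \is a fin_num.
  rewrite ge0_fin_numE// ltNge leye_eq; apply/negP => /eqP Jy.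
  have := vfin; rewrite /Lp_norm -/(power_mass v) Jy poweRyr ?ltxx//.
  by rewrite invr_eq0 gt_eqF.
pose B := 2 * (C2 + C1 * fine (power_mass v)).
have orbit t : 0 <= t -> (mean (T t v) <= B%:E)%E.
  move=> t0; apply: le_trans (gaussian_mean_shifted_semigroup rho c hRt hRp hkappa hE hM t0 mr mi) _.
  rewrite /B (EFinM 2) (EFinD C2) (EFinM C1) fineK// lee_wpmul2l ?lee_fin//.
  by apply: HC => // x; exact: normc_ge0.
pose S := B + (C2 + C1).
have bound A : 0 <= A -> (A%:E * test_mean <= S%:E)%E.
  move=> A0; have LA := test_Lp A0.
  have [t t0 Ht] := dense _ LA 1 ltr01.
  have [mTr mTi] := measurable_shifted_semigroup M rho c hE t mr mi.
  have [mtr mti _] := LA.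
  have mD : measurable_fun setT (fun x => normc ((T t v - test A) x)).
    apply: measurable_normc.
      rewrite (_ : (fun x => _) = (fun x => complex.Re (T t v x) - complex.Re (test A x))).
        exact: measurable_funB.
      by apply/funext => x; rewrite -[(T t v - _) x]/(T t v x - _); case: (T t v x).
    rewrite (_ : (fun x => _) = (fun x => complex.Im (T t v x) - complex.Im (test A x))).
      exact: measurable_funB.
    by apply/funext => x; rewrite -[(T t v - _) x]/(T t v x - _); case: (T t v x).
  rewrite -mean_test//; apply: le_trans (mean_add_le _ _ mD) _.
  - exact: measurable_normc.
  - exact: measurable_normc.
  - rewrite /S EFinD leeD//; first exact: orbit.
    exact: mean_small_norm Ht.
have m1 : test_mean \is a fin_num.
  rewrite ge0_fin_numE ?ltW//; have := bound 1 ler01; rewrite mul1e.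
  by move=> /le_lt_trans; apply; exact: ltry.
have r0 : 0 < fine test_mean by rewrite -lte_fin fineK.
have S0 : 0 <= S.
  rewrite /S addr_ge0 ?(addr_ge0 C20 C10)// /B.
  by rewrite mulr_ge0// addr_ge0// mulr_ge0// fine_ge0.
have := bound _ (divr_ge0 (addr_ge0 S0 ler01) (ltW r0)).
rewrite -{2}(fineK m1) -EFinM lee_fin divfK ?gt_eqF//; lra.
Qed.

End unbounded_orbits.

Theorem theorem1p6 (R : realType) (n : nat) (hn : (2 <= n)%N)
    (Rt Rp : {fset 'rV[R]_n}) (kappa : 'rV[R]_n -> R)
    (E : 'rV[R]_n -> 'rV[R]_n -> R) (M rho : R)
    (hRt : root_system Rt) (hRp : positive_roots Rt Rp)
    (hkappa : multiplicity_function Rt kappa)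
    (hE : dunkl_kernel Rp kappa E) (hM : heat_normalized Rp kappa E M)
    (hrho : 0 < rho) :
  (forall p c : R, 1 <= p -> p < 2 ->
     (c%:E < (2 * rho ^+ 2)%:E / hoelder_conjugate p%:E)%E ->
     ~ hypercyclic_on_Lp Rp kappa E M rho p c) /\
  (forall p c : R, 2 < p -> c < 2 * rho ^+ 2 / p ->
     ~ hypercyclic_on_Lp Rp kappa E M rho p c).
Proof.
have r2 : 0 < rho ^+ 2 by rewrite exprn_gt0.
(* the rate [4 / (p p')] is at least [2 / p'] for [p <= 2] and at least [2 / p]
   for [p >= 2] *)
have gE (p : R) : 0 < p -> 1 - gamma_p p ^+ 2 = 4 * p^-1 * (1 - p^-1).
  by move=> p0; rewrite /gamma_p real_normK ?num_real//; field; rewrite gt_eqF.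
split=> p c.
  move=> p1 p2 hc; have p0 : 0 < p by exact: lt_le_trans p1.
  have pn2 : p != 2 by rewrite lt_eqF.
  apply: (not_hypercyclic hn hRt hRp hkappa hE hM hrho p1 pn2).
  have pV : 2^-1 <= p^-1 by rewrite lef_pV2 ?posrE// ltW.
  have pV1 : p^-1 <= 1 by rewrite invf_le1.
  have {}hc : c < 2 * rho ^+ 2 * (1 - p^-1).
    move: hc p1; rewrite le_eqVlt => + /predU1P[p1|p1].
      rewrite -p1 hoelder_conjugate1 invey mule0 lte_fin => /lt_le_trans; apply.
      by rewrite invr1 subrr mulr0.
    have pm : 0 < p - 1 by rewrite subr_gt0.
    rewrite /hoelder_conjugate/= eqe (gt_eqF p0) -EFinB inver (gt_eqF pm) -EFinM.
    rewrite inver gt_eqF ?mulr_gt0 ?invr_gt0// -EFinM lte_fin.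
    suff -> : (p / (p - 1))^-1 = 1 - p^-1 by [].
    by field; rewrite !gt_eqF.
  rewrite gE//; apply: lt_le_trans hc _.
  have a1 : 0 <= 1 - p^-1 by rewrite subr_ge0.
  have a2 : 0 <= 2 * p^-1 - 1 by lra.
  have := mulr_ge0 (mulr_ge0 (ltW r2) a1) a2; lra.
move=> p2 hc; have p0 : 0 < p by exact: lt_trans p2.
have p1 : 1 <= p by rewrite ltW// (lt_trans _ p2)// ltr1n.
have pn2 : p != 2 by rewrite gt_eqF.
apply: (not_hypercyclic hn hRt hRp hkappa hE hM hrho p1 pn2).
have pV : p^-1 <= 2^-1 by rewrite lef_pV2 ?posrE// ltW.
have pV0 : 0 < p^-1 by rewrite invr_gt0.
rewrite gE//; apply: lt_le_trans hc _.
have a2 : 0 <= 1 - 2 * p^-1 by lra.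
have := mulr_ge0 (mulr_ge0 (ltW r2) (ltW pV0)) a2; lra.
Qed.
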